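(* Let $n\geq 4$. The $n$-dimensional real Bott manifolds $M(A)$ that admit the maximal $T^k$-action for some $k\geq n-2$ (i.e. $k\in\{n-2,n-1,n\}$) form exactly $6$ diffeomorphism classes.
   Context: A Bott matrix of size $n$ is an $n\times n$ upper triangular matrix $A=(a_{ij})$ with $a_{ii}=1$ for all $i$ and $a_{ij}\in\{0,1\}$ for $i<j$. Let $S^1\subset\mathbb{C}$ be the unit circle and $T^n=(S^1)^n$. A Bott matrix $A$ defines a free action of $(\mathbb{Z}_2)^n=\langle g_1,\dots,g_n\rangle$ on $T^n$ by $$g_i(z_1,\dots,z_n)=(z_1,\dots,z_{i-1},-z_i,\tilde z_{i+1},\dots,\tilde z_n),$$ where for $j>i$, $\tilde z_j=\bar z_j$ if $a_{ij}=1$ and $\tilde z_j=z_j$ if $a_{ij}=0$. The quotient smooth manifold $M(A)=T^n/(\mathbb{Z}_2)^n$ is called an ($n$-dimensional) real Bott manifold. $M(A)$ is said to admit the maximal $T^k$-action, where $k$ ($1\le k\le n$) is the number of columns of $A$ whose only nonzero entry is the diagonal entry. Equivalently, $k$ is the rank of the maximal central free abelian subgroup of $\pi_1(M(A))$; in particular $k$ is a diffeomorphism invariant of $M(A)$. *)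

(* Defs.v *)
From HB Require Import structures.
From mathcomp Require Import all_boot all_order all_algebra.
From mathcomp Require Import all_classical all_reals all_analysis.
From mathcomp Require Import complex.

Set Implicit Arguments.
Unset Strict Implicit.
Unset Printing Implicit Defensive.

Import Order.TTheory GRing.Theory Num.Theory.
Import numFieldNormedType.Exports.

Local Open Scope classical_set_scope.
Local Open Scope ring_scope.

Definition is_bott (n : nat) (A : 'M[bool]_n) : bool :=
  [forall i : 'I_n, A i i] &&
  [forall i : 'I_n, forall j : 'I_n, (j < i)%N ==> ~~ A i j].

(* The k such that M(A) admits the maximal T^k-action. The diagonal entries of
   a Bott matrix are 1, so the only nonzero entry of column j is the diagonal
   one iff all its other entries vanish. *)
Definition max_torus_rank (n : nat) (A : 'M[bool]_n) : nat :=
  #|[pred j : 'I_n | [forall i : 'I_n, (i != j) ==> ~~ A i j]]|.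

Section RealBott.
Variable R : realType.

Record circle := Circle { cval : R[i]; _ : `|cval| == 1 }.
HB.instance Definition _ := [isSub for cval].
HB.instance Definition _ := [Choice of circle by <:].

Fact cneg_subproof (z : circle) : `|- val z| == 1.
Proof. by rewrite normrN (valP z). Qed.
Definition cneg (z : circle) : circle := Circle (cneg_subproof z).

Fact cconj_subproof (z : circle) : `|(val z)^*| == 1.
Proof. by rewrite norm_conjC (valP z). Qed.
Definition cconj (z : circle) : circle := Circle (cconj_subproof z).

Fact cexp_subproof (t : R) : `|(cos t +i* sin t)%C| == 1.
Proof. by rewrite normc_def /= cos2Dsin2 sqrtr1. Qed.
Definition cexp (t : R) : circle := Circle (cexp_subproof t).

Lemma cnegK : involutive cneg.
Proof. by move=> z; apply/val_inj; rewrite /= opprK. Qed.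

Lemma cconjK : involutive cconj.
Proof. by move=> z; apply/val_inj; rewrite /= conjCK. Qed.

Section Dimension.
Variable n : nat.

Definition torus := {ffun 'I_n -> circle}.

Section Quotient.
Variable A : 'M[bool]_n.

Definition bott_gen (i : 'I_n) (z : torus) : torus :=
  [ffun j : 'I_n => if j == i then cneg (z j)
                    else if (i < j)%N && A i j then cconj (z j) else z j].

Lemma bott_genK i : involutive (bott_gen i).
Proof.
move=> z; apply/ffunP => j; rewrite !ffunE.
case: (j == i); first by rewrite cnegK.
by case: (_ && _); rewrite ?cconjK.
Qed.

(* z and w lie in the same orbit of the group generated by the g_i. As the g_i
   are involutions, the elements of this group are the words in the g_i. *)
Definition bott_orbit (z w : torus) : bool :=
  `[< exists s : seq 'I_n, w = foldr bott_gen z s >].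

Lemma bott_orbit_refl : reflexive bott_orbit.
Proof. by move=> z; apply/asboolP; exists [::]. Qed.

Lemma bott_orbit_sym : symmetric bott_orbit.
Proof.
have sub z w : bott_orbit z w -> bott_orbit w z.
  move=> /asboolP[s ->]; apply/asboolP; exists (rev s).
  elim: s => [//|i s {1}->]; rewrite rev_cons -cats1 foldr_cat /=.
  by rewrite bott_genK.
by move=> z w; apply/idP/idP; apply: sub.
Qed.

Lemma bott_orbit_trans : transitive bott_orbit.
Proof.
move=> w z v /asboolP[s ->] /asboolP[t ->]; apply/asboolP.
by exists (t ++ s); rewrite foldr_cat.
Qed.

Canonical bott_orbit_equiv :=
  EquivRel bott_orbit bott_orbit_refl bott_orbit_sym bott_orbit_trans.

Definition bott_manifold := {eq_quot bott_orbit}%qT.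

(* The composite R^n -> T^n -> M(A) of two coverings. The smooth structures of
   T^n and of the quotient of T^n by a free action of a finite group are those
   for which these coverings are local diffeomorphisms. *)
Definition bott_param (x : 'rV[R]_n) : bott_manifold :=
  \pi_bott_manifold%qT [ffun j => cexp (x ord0 j)].

(* The inverse of bott_param restricted to U is then a smooth chart of M(A);
   such charts form an atlas. *)
Definition chart_domain (U : set 'rV[R]_n) : Prop :=
  open U /\ set_inj U bott_param.

End Quotient.

(* f is C^k on the open set U, in terms of iterated partial derivatives. *)
Fixpoint Ck_on (k : nat) (U : set 'rV[R]_n) (f : 'rV[R]_n -> 'rV[R]_n) : Prop :=
  (forall x, U x -> {for x, continuous f}) /\
  match k with
  | 0 => True
  | k'.+1 => forall i : 'I_n,
      (forall x, U x -> derivable f x (delta_mx ord0 i)) /\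
      Ck_on k' U ('D_(delta_mx ord0 i) f)
  end.

Definition smooth_on (U : set 'rV[R]_n) (f : 'rV[R]_n -> 'rV[R]_n) : Prop :=
  forall k, Ck_on k U f.

(* Around every point m there are charts in which f reads as a smooth map F. *)
Definition smooth_map (A B : 'M[bool]_n)
    (f : bott_manifold A -> bott_manifold B) : Prop :=
  forall m : bott_manifold A,
    exists (U V : set 'rV[R]_n) (F : 'rV[R]_n -> 'rV[R]_n),
      [/\ chart_domain A U, chart_domain B V & (bott_param A @` U) m] /\
      [/\ smooth_on U F, (forall x, U x -> V (F x)) &
          forall x, U x -> f (bott_param A x) = bott_param B (F x)].

Definition diffeomorphic (A B : 'M[bool]_n) : Prop :=
  exists (f : bott_manifold A -> bott_manifold B)
         (g : bott_manifold B -> bott_manifold A),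
    [/\ cancel f g, cancel g f, smooth_map f & smooth_map g].

End Dimension.
End RealBott.

Arguments diffeomorphic R {n} A B.

(* Main.v *)
(* The composite R^n -> T^n -> M(A) is the quotient map of a group Gamma_A of
   isometries x_j |-> +-x_j + pi m_j. As nontrivial elements move every point by
   at least pi, it is a covering, so a diffeomorphism M(A) -> M(B) lifts to R^n
   and conjugates Gamma_A to Gamma_B. Conversely an affine bijection conjugating
   Gamma_A to Gamma_B induces a diffeomorphism; three such moves (permuting
   coordinates, changing the basis among trivial columns, a quarter turn of a
   circle) bring a Bott matrix with at most two nontrivial columns to one of six
   normal forms.

   An isomorphism of the groups induces an isomorphism P of H^1(-; F_2) that
   preserves the relations x_j^2 = alpha_j x_j of the cohomology rings, where
   alpha_j = \sum_(i < j) a_ij x_i is the sign character of the j-th coordinate.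
   A few entries of P show that this is impossible between distinct normal
   forms. *)
Require Import Defs.
From mathcomp Require Import all_boot all_order all_algebra.
From mathcomp Require Import all_classical all_reals all_analysis.
From mathcomp Require Import fingroup perm complex.
From mathcomp Require Import ring lra zify.

Set Implicit Arguments.
Unset Strict Implicit.
Unset Printing Implicit Defensive.

Import Order.TTheory GRing.Theory Num.Theory.
Import numFieldNormedType.Exports.

(** * The group of lifts *)

Section BottGroup.
Local Open Scope ring_scope.
Variable n : nat.
Implicit Types (A : 'M[bool]_n) (m : 'rV[int]_n).

(** The argument closes a loop. A diffeomorphism yields an equivariant bijection of R^n, of which no
    regularity is kept; that bijection yields P, and P determines the normal form; equal normal
    forms give back an affine bijection, hence a diffeomorphism. On the matrices considered,
    diffeomorphism thus coincides with relations whose symmetry and transitivity are immediate, and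
    composition of smooth maps in charts never enters.

    The relations on P are obtained without constructing cohomology rings. On the group, m |-> m_j
    %/ 2 has coboundary (alpha_j + x_j) x_j mod 2. Pulled back along the isomorphism and evaluated
    on both sides of g_i g_k = g_k^(+-1) g_i, it gives quadratic identities between the entries of
    P.

    The reduction is finite because the rows, cut down to the two nontrivial columns, are vectors of
    F_2^2: two of them carry the whole span. Since n >= 4, rows 0 and 1 lie above the last two and
    can play this part; with the entry joining the two columns, 32 states remain. *)

Definition bit (k : int) : 'F_2 := k%:~R.

Definition sgF (b : 'F_2) : int := if b == 0 then 1 else -1.

Lemma F2_cases (b : 'F_2) : b = 0 \/ b = 1.
Proof. by case: b => [[|[|//]] ib]; [left|right]; apply/val_inj. Qed.

Lemma addFF (b : 'F_2) : b + b = 0.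
Proof. by case: (F2_cases b) => ->; apply/val_inj. Qed.

Lemma oppF (b : 'F_2) : - b = b.
Proof. by apply/eqP; rewrite eq_sym -addr_eq0 addFF. Qed.

Lemma sgF0 : sgF 0 = 1. Proof. by []. Qed.

Lemma sgFD b c : sgF (b + c) = sgF b * sgF c.
Proof. by case: (F2_cases b) => ->; case: (F2_cases c) => ->. Qed.

Lemma sgFK b : sgF b * sgF b = 1.
Proof. by rewrite -sgFD addFF. Qed.

Lemma bit_sgF b k : bit (sgF b * k) = bit k.
Proof.
rewrite /sgF; case: eqP => _; first by rewrite mul1r.
by rewrite mulN1r /bit rmorphN /= oppF.
Qed.

Lemma bitD k l : bit (k + l) = bit k + bit l.
Proof. exact: rmorphD. Qed.

Lemma bit0P k : bit k = 0 -> {l | k = l + l}.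
Proof.
move=> k0; exists (k %/ 2)%Z.
suff : (k %% 2)%Z = 0 by have := divz_eq k 2; lia.
have : bit (k %% 2)%Z = 0.
  move: k0; rewrite {1}(divz_eq k 2) bitD /bit rmorphM /=.
  by rewrite (_ : 2%:~R = 0) ?mulr0 ?add0r //; apply/val_inj.
have := modz_ge0 k (_ : 2 != 0); have := ltz_pmod k (_ : 0 < 2).
move=> /(_ isT) + /(_ isT); case: (k %% 2)%Z => // -[|[|]] //.
Qed.

(* Entries on or below the diagonal play no role in [bott_gen]. *)
Definition cF A (i j : 'I_n) : 'F_2 := ((i < j)%N && A i j)%:R.

Definition par A m j : 'F_2 := \sum_i cF A i j * bit (m 0 i).

(* The law of Gamma_A, whose elements x_j |-> +-x_j + pi m_j are encoded by m;
   the signs are determined by m through [par]. *)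
Definition bmul A m m' : 'rV[int]_n :=
  \row_j (m 0 j + sgF (par A m j) * m' 0 j).

Definition binv A m : 'rV[int]_n := \row_j (- (sgF (par A m j) * m 0 j)).

Lemma cF_ge A (i j : 'I_n) : (j <= i)%N -> cF A i j = 0.
Proof. by rewrite /cF ltnNge => ->. Qed.

Lemma bit_bmul A m m' j : bit (bmul A m m' 0 j) = bit (m 0 j) + bit (m' 0 j).
Proof. by rewrite mxE bitD bit_sgF. Qed.

Lemma par_bmul A m m' j : par A (bmul A m m') j = par A m j + par A m' j.
Proof.
by rewrite -big_split /=; apply: eq_bigr => i _; rewrite bit_bmul mulrDr.
Qed.

Lemma par0 A j : par A 0 j = 0.
Proof. by apply: big1 => i _; rewrite mxE mulr0. Qed.

Lemma eq_par A m m' j : (forall i, bit (m 0 i) = bit (m' 0 i)) ->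
  par A m j = par A m' j.
Proof. by move=> mm'; apply: eq_bigr => i _; rewrite mm'. Qed.

Lemma bit_binv A m j : bit (binv A m 0 j) = bit (m 0 j).
Proof. by rewrite mxE /bit rmorphN oppF; exact: bit_sgF. Qed.

Lemma par_binv A m j : par A (binv A m) j = par A m j.
Proof. by apply: eq_par => i; rewrite bit_binv. Qed.

Lemma bmulA A : associative (bmul A).
Proof.
move=> a b c; apply/rowP => j; rewrite ![in LHS]mxE ![in RHS]mxE.
by rewrite par_bmul sgFD; ring.
Qed.

Lemma bmul1m A : left_id 0 (bmul A).
Proof. by move=> a; apply/rowP => j; rewrite !mxE par0 mul1r add0r. Qed.

Lemma bmulm1 A : right_id 0 (bmul A).
Proof. by move=> a; apply/rowP => j; rewrite !mxE mulr0 addr0. Qed.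

Lemma bmulV A m : bmul A (binv A m) m = 0.
Proof. by apply/rowP => j; rewrite !mxE par_binv addNr. Qed.

Lemma bmulmV A m : bmul A m (binv A m) = 0.
Proof. by apply/rowP => j; rewrite !mxE mulrN mulrA sgFK mul1r subrr. Qed.

End BottGroup.

(** * The isometric action of the group on R^n *)

Section Action.
Local Open Scope ring_scope.
Local Open Scope classical_set_scope.
Variables (R : realType) (n : nat).
Implicit Types (A : 'M[bool]_n) (m : 'rV[int]_n) (x y : 'rV[R]_n).

Definition act A m x : 'rV[R]_n :=
  \row_j ((sgF (par A m j))%:~R * x 0 j + pi * (m 0 j)%:~R).

Lemma act_bmul A m m' x : act A (bmul A m m') x = act A m (act A m' x).
Proof.
apply/rowP => j; rewrite !mxE par_bmul sgFD !(rmorphD, rmorphM) /=; ring.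
Qed.

Lemma act0 A x : act A 0 x = x.
Proof. by apply/rowP => j; rewrite !mxE par0 mul1r mulr0 addr0. Qed.

Lemma actVK A m : cancel (act A m) (act A (binv A m)).
Proof. by move=> x; rewrite -act_bmul bmulV act0. Qed.

Lemma act_dist A m x y j :
  `|act A m x 0 j - act A m y 0 j| = `|x 0 j - y 0 j|.
Proof.
rewrite !mxE opprD addrACA subrr addr0 -mulrBr normrM.
by rewrite /sgF; case: ifP => _; rewrite ?mulr1z ?normrN1 ?normr1 mul1r.
Qed.

(** Strong induction on j: once the entries of m below j vanish, the sign at j is +, so coordinate j
    moves by exactly pi |m_j|, which is less than pi only for m_j = 0. Freeness of the action and
    injectivity of [bott_param] on small sets rest on this. *)
Lemma act_discrete A m x :
  (forall j, `|act A m x 0 j - x 0 j| < pi) -> m = 0.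
Proof.
move=> d; apply/rowP => j; rewrite mxE.
elim: {j}(j.+1) {-2}j (ltnSn j) => // k IH j; rewrite ltnS => jk.
have pj : par A m j = 0.
  apply: big1 => i _; have [ij|ij] := ltnP i j; last by rewrite cF_ge ?mul0r.
  by rewrite (IH i) ?mulr0 // (leq_trans ij).
have := d j; rewrite mxE pj sgF0 mul1r addrC addKr normrM gtr0_norm ?pi_gt0 //.
rewrite gtr_pMr ?pi_gt0 // -intr_norm ltrz1; lia.
Qed.

Lemma act_inj A m m' x : act A m x = act A m' x -> m = m'.
Proof.
move=> e; have : bmul A (binv A m) m' = 0.
  apply: (@act_discrete A _ x) => j.
  by rewrite act_bmul -e actVK subrr normr0 pi_gt0.
by move=> /(congr1 (bmul A m)); rewrite bmulA bmulmV bmul1m bmulm1.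
Qed.

End Action.

(** * The fibres of R^n -> M(A) are the orbits of the group *)

Section Param.
Local Open Scope ring_scope.
Local Open Scope classical_set_scope.
Variables (R : realType) (n : nat).
Implicit Types (A : 'M[bool]_n) (m : 'rV[int]_n) (x y : 'rV[R]_n).

Lemma cos_eq1 (t : R) : 0 <= t < 2 * pi -> cos t = 1 -> t = 0.
Proof.
move=> /andP[t0 t2] ct; apply/eqP; rewrite eq_le t0 andbT leNgt; apply/negP.
move=> tp; have : 0 < sin (t / 2).
  by apply: sin_gt0_pi; rewrite divr_gt0 //= ltr_pdivrMr // mulrC.
have /eqP := ct; rewrite {1}(_ : t = (t / 2) *+ 2) ?cos_mulr2n ?cos2sin2; last first.
  by rewrite -mulr_natr divfK.
move=> /eqP e; have /eqP : sin (t / 2) ^+ 2 = 0 by lra.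
by rewrite sqrf_eq0 => /eqP ->; rewrite ltxx.
Qed.

Lemma cosD2piz (t : R) (k : int) : cos (t + 2 * pi * k%:~R) = cos t.
Proof.
have nat_case (s : R) (l : nat) : cos (s + 2 * pi * l%:R) = cos s.
  rewrite -[RHS](periodicn (@cosD2pi R) l); congr (cos (_ + _)).
  by rewrite -[RHS]mulr_natr -(mulr_natr pi 2); ring.
case: k => l; first exact: nat_case.
by rewrite NegzE rmorphN /= -[LHS](nat_case _ l.+1) pmulrn; congr cos; ring.
Qed.

Lemma sinD2piz (t : R) (k : int) : sin (t + 2 * pi * k%:~R) = sin t.
Proof. by rewrite -!cosBpihalf addrAC cosD2piz. Qed.

Lemma cexp_eqP (s t : R) :
  cexp s = cexp t <-> exists k : int, t = s + 2 * pi * k%:~R.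
Proof.
split=> [|[k ->]]; last first.
  by apply/val_inj; rewrite /= cosD2piz sinD2piz.
move=> /(congr1 val) /= [cst sst].
have pi2 : 0 < 2 * pi :> R by rewrite mulr_gt0 ?pi_gt0.
pose k := Num.floor ((t - s) / (2 * pi)); exists k.
have /andP[k1 k2] : k%:~R <= (t - s) / (2 * pi) < (k + 1)%:~R by exact: floor_itv.
have : t - s + 2 * pi * (- k)%:~R = 0.
  apply: cos_eq1.
    move: k1 k2; rewrite ler_pdivlMr // ltr_pdivrMr // rmorphD rmorphN /= => k1 k2.
    by apply/andP; split; lra.
  by rewrite cosD2piz cosB -cst -sst -!expr2 cos2Dsin2.
by rewrite rmorphN /=; lra.
Qed.

Lemma cexp_surj (z : circle R) : exists t : R, cexp t = z.
Proof.
case: z => -[a b] abP; have /eqP := abP; rewrite normc_def /= => -[ab].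
have ab1 : a ^+ 2 + b ^+ 2 = 1.
  rewrite -[LHS]sqr_sqrtr ?ab ?expr1n // addr_ge0 ?sqr_ge0 //.
have a1 : -1 <= a <= 1.
  by rewrite -ler_norml -(@ler_pXn2r _ 2) ?nnegrE // expr1n real_normK ?num_real //;
    nra.
have sb : sin (acos a) = `|b|.
  by rewrite sin_acos // (_ : 1 - _ = b ^+ 2) ?sqrtr_sqr //; lra.
have ca : cos (acos a) = a by rewrite acosK.
have [b0|b0] := leP 0 b.
  by exists (acos a); apply/val_inj; rewrite /= ca sb ger0_norm.
exists (- acos a); apply/val_inj; rewrite /= cosN sinN ca sb ltr0_norm //.
by rewrite opprK.
Qed.

Definition texp x : torus R n := [ffun j => cexp (x ord0 j)].

Lemma texp_eqP x y :
  texp x = texp y <-> exists k :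
    'rV[int]_n, forall j, y 0 j = x 0 j + 2 * pi * (k 0 j)%:~R.
Proof.
split=> [/ffunP e|[k e]].
  have : forall j, exists k : int, y 0 j = x 0 j + 2 * pi * k%:~R.
    by move=> j; apply/cexp_eqP; have := e j; rewrite !ffunE.
  by move=> /choice[k kP]; exists (\row_j k j) => j; rewrite mxE kP.
by apply/ffunP => j; rewrite !ffunE; apply/cexp_eqP; exists (k 0 j).
Qed.

Lemma bott_gen_texp A i x :
  bott_gen A i (texp x) = texp (act A (delta_mx 0 i) x).
Proof.
have parE j : par A (delta_mx 0 i) j = cF A i j.
  rewrite /par (bigD1 i) //= big1 ?addr0 ?mxE ?eqxx ?mulr1 //.
  by move=> k /negbTE ki; rewrite mxE ki andbF mulr0.
apply/ffunP => j; rewrite !ffunE !mxE parE eqxx /=.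
case: eqVneq => [->|ji].
  rewrite cF_ge // sgF0 mul1r mulr1; apply/val_inj => /=.
  by rewrite cosDpi sinDpi.
rewrite mulr0 addr0 /cF; case: ifP => _ /=; last by rewrite mul1r.
by rewrite mulN1r; apply/val_inj; rewrite /= cosN sinN.
Qed.

Lemma bott_param_eq A x y : bott_param A x = bott_param A y <->
  exists s, texp y = foldr (bott_gen A) (texp x) s.
Proof.
rewrite /bott_param -/(texp x) -/(texp y); split.
  by move=> /eqmodP/asboolP.
by move=> e; apply/eqmodP/asboolP.
Qed.

(** Even vectors encode the deck translations of R^n -> T^n, by multiples of 2 pi. *)
Lemma texp_act_even A (k : 'rV[int]_n) x : texp (act A (k + k) x) = texp x.
Proof.
apply/esym/texp_eqP; exists k => j; rewrite !mxE.
rewrite (@eq_par _ _ _ 0) ?par0 => [|i].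
  by rewrite mul1r rmorphD /=; ring.
by rewrite !mxE bitD addFF.
Qed.

(** Induction on the number of odd entries of m. Splitting off a lift of g_i on the left makes the
    odd entry i even, keeps the other parities and stays in the orbit. With no odd entry left, m is
    a deck translation of the torus. *)
Lemma bott_param_act A m x : bott_param A (act A m x) = bott_param A x.
Proof.
have [c] := ubnP #|[pred i | bit (m 0 i) != 0]|.
elim: c m => // c IH m; rewrite ltnS => mc.
have [i /= mi|m0] := pickP [pred i | bit (m 0 i) != 0].
  pose d : 'rV[int]_n := delta_mx 0 i.
  rewrite -[m](bmul1m A) -(bmulmV A d) -bmulA act_bmul.
  rewrite -[RHS](IH (bmul A (binv A d) m)).
    apply/esym/bott_param_eq; exists [:: i].
    by rewrite /= bott_gen_texp.
  apply: leq_trans mc; apply: proper_card; apply/properP; split.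
    apply/fintype.subsetP => j; rewrite !inE bit_bmul bit_binv !mxE eqxx /=.
    have [->|ji] := eqVneq j i; first by rewrite mi.
    by rewrite add0r.
  exists i; rewrite ?inE //= bit_bmul bit_binv !mxE !eqxx /= negbK.
  by case: (F2_cases (bit (m 0 i))) mi => ->.
have /choice[k kP] : forall i, exists l, m 0 i = l + l.
  by move=> i; have /negbFE/eqP/bit0P[l ->] := m0 i; exists l.
have -> : m = (\row_i k i) + (\row_i k i) by apply/rowP => i; rewrite !mxE.
by rewrite /bott_param -!/(texp _) texp_act_even.
Qed.

Lemma bott_paramP A x y :
  bott_param A x = bott_param A y <-> exists m, y = act A m x.
Proof.
split=> [/bott_param_eq[s e]|[m ->]]; last by rewrite bott_param_act.
have [m me] : exists m, foldr (bott_gen A) (texp x) s = texp (act A m x).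
  elim: s {e} => [|i s [m IH]] /=; first by exists 0; rewrite act0.
  by exists (bmul A (delta_mx 0 i) m); rewrite IH bott_gen_texp act_bmul.
move: e; rewrite me => /esym/texp_eqP[k yk].
(* The word in the generators determines y only up to 2 pi k; the even vector k + k, applied after
   m, supplies this translation. *)
exists (bmul A (k + k) m); apply/rowP => j; rewrite yk act_bmul !mxE.
rewrite (@eq_par _ _ (k + k) 0) ?par0 => [|i]; last by rewrite !mxE bitD addFF.
by rewrite mul1r rmorphD /=; ring.
Qed.

Lemma bott_param_surj A (p : bott_manifold R A) : exists x, bott_param A x = p.
Proof.
elim/quotW: p => z.
have /choice[t tP] : forall j, exists t, cexp t = z j by move=> j; exact: cexp_surj.
exists (\row_j t j); congr (\pi_ _ _)%qT.
by apply/ffunP => j; rewrite ffunE mxE tP.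
Qed.

End Param.

(** * Lifting continuous maps through the covering *)

Section Lebesgue.
Local Open Scope ring_scope.
Local Open Scope classical_set_scope.
Variable R : realType.

(** Compactness in its near-covering form, applied to radii tending to 0 from the right. As Q passes
    to subsets, a good radius d at x serves all centres within d / 2 and all radii below d / 2. *)
Lemma lebesgue_number (T : pseudoMetricType R) (K : set T) (Q : set T -> Prop) :
  compact K -> (forall S S' : set T, S `<=` S' -> Q S' -> Q S) ->
  (forall x, K x -> exists2 d : R, 0 < d & Q (ball x d)) ->
  exists2 d : R, 0 < d & forall x, K x -> Q (ball x d).
Proof.
move=> /compact_near_coveringP cK Qm Qloc.
have := cK _ (0^'+ : set_system R) (fun e x => Q (ball x e)) _.
case=> [x Kx|].
  have [d d0 Qd] := Qloc x Kx.
  exists (ball x (d / 2), [set e | e < d / 2]) => /=.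
    by split; [apply: nbhsx_ballx; rewrite divr_gt0|apply: nbhs_right_lt;
      rewrite divr_gt0].
  move=> [y e] /= [xy ed]; apply: Qm Qd => z yz.
  rewrite (splitr d); apply: ball_triangle xy _.
  exact: le_ball (ltW ed) _ yz.
move=> d /= d0 dP; exists (d / 2); first by rewrite divr_gt0.
move=> x Kx; apply: dP Kx; last by rewrite divr_gt0.
by rewrite /= sub0r normrN gtr0_norm ?divr_gt0 // ltr_pdivrMr // ltr_pMr // ltr1n.
Qed.

(** Connectedness of [0, 1]: with a Lebesgue number d, the interval is crossed in N steps of length
    1 / N < d, none of which changes P. *)
Lemma segment_constant (P : R -> Prop) :
  (forall t : R, 0 <= t <= 1 -> exists2 d : R, 0 < d &
     forall s : R, 0 <= s <= 1 -> `|t - s| < d -> (P s <-> P t)) ->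
  P 0 -> P 1.
Proof.
move=> Ploc P0.
have [|S S' SS' QS s t sI tI Ss St|t|d d0 dP] := @lebesgue_number R `[0, 1]
  (fun S => forall s t : R, 0 <= s <= 1 -> 0 <= t <= 1 -> S s -> S t -> (P s <-> P t)).
- exact: segment_compact.
- by apply: QS => //; apply: SS'.
- rewrite /= in_itv /= => tI; have [d d0 dP] := Ploc t tI; exists d => // s s' sI s'I.
  by rewrite /ball /= => ts ts'; rewrite (dP s) // (dP s').
pose N := (Num.trunc d^-1).+1.
have N0 : 0 < N%:R :> R by rewrite ltr0n.
have Nd : N%:R^-1 < d.
  by rewrite invf_plt ?posrE //; apply: truncnS_gt.
suff : forall k, (k <= N)%N -> P (k%:R / N%:R).
  by move=> /(_ N (leqnn N)); rewrite divff ?gt_eqF.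
have kI (k : nat) : (k <= N)%N -> (0 <= (k%:R / N%:R : R) <= 1)%R.
  move=> kN; have le1 : k%:R / N%:R <= 1 :> R by rewrite ler_pdivrMr // mul1r ler_nat.
  by rewrite le1 andbT divr_ge0.
elim=> [|k IH] kN; first by rewrite mul0r.
have {IH} Pk := IH (ltnW kN).
have k0 : `[0, 1]%classic (k%:R / N%:R : R) by rewrite /= in_itv /= kI // ltnW.
apply: (proj2 (dP _ k0 (k.+1%:R / N%:R) (k%:R / N%:R) _ _ _ _)) Pk.
- exact: kI.
- exact/kI/ltnW.
- rewrite /ball /= -mulrBl -opprB -natrB // subSnn mulN1r normrN gtr0_norm ?invr_gt0 //.
- exact: ballxx.
Qed.

End Lebesgue.

(** * Lifts: uniqueness on convex sets, gluing along slices, existence on R^n *)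

Section Lift.
Local Open Scope ring_scope.
Local Open Scope classical_set_scope.
Variables (R : realType) (n : nat).
Local Notation V := 'rV[R]_n.
Implicit Types (A B : 'M[bool]_n) (m : 'rV[int]_n) (x y : V) (S : set V).

(** The balls of R^n written by coordinates, where [act] is visibly isometric. *)
Definition near_by (d : R) x y := forall j, `|x 0 j - y 0 j| < d.

Definition near_cont S (F : V -> V) := forall x, S x -> forall e : R, 0 < e ->
  exists2 d : R, 0 < d & forall y, S y -> near_by d x y -> near_by e (F x) (F y).

Definition convex_in S := forall x y (t : R), S x -> S y -> 0 <= t <= 1 ->
  S (x + t *: (y - x)).

Lemma near_by_triangle (d e : R) x y z :
  near_by d x y -> near_by e y z -> near_by (d + e) x z.
Proof.
move=> xy yz j; rewrite (_ : _ - _ = (x 0 j - y 0 j) + (y 0 j - z 0 j)); last by ring.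
by apply: le_lt_trans (ler_normD _ _) _; apply: ltrD.
Qed.

Lemma near_by_sym (d : R) x y : near_by d x y -> near_by d y x.
Proof. by move=> xy j; rewrite distrC. Qed.

Lemma near_byW (d e : R) x y : d <= e -> near_by d x y -> near_by e x y.
Proof. by move=> de xy j; exact: lt_le_trans (xy j) de. Qed.

Lemma ball_near_by (d : R) x y : 0 < d -> ball x d y <-> near_by d x y.
Proof.
move=> d0; split=> [[_ xy] j|xy]; first exact: xy.
by split => // i j; rewrite ord1; exact: xy.
Qed.

Lemma near_by_bound x : exists2 M : R, 0 < M & forall j, `|x 0 j| < M.
Proof.
exists (\sum_j `|x 0 j| + 1).
  by rewrite ltr_wpDl // sumr_ge0.
move=> j; rewrite (bigD1 j) //= -addrA ltrDl ltr_wpDl // sumr_ge0 //.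
Qed.

Lemma bott_param_near B x y :
  bott_param B x = bott_param B y -> near_by pi x y -> x = y.
Proof.
move=> /bott_paramP[m ->] xy; rewrite (_ : m = 0) ?act0 //.
by apply: (@act_discrete R _ B _ x) => j; rewrite distrC; exact: xy.
Qed.

Variables (B : 'M[bool]_n) (h : V -> bott_manifold R B).

Definition lift_on S F := (forall x, S x -> bott_param B (F x) = h x) /\ near_cont S F.

Lemma lift_onS S S' F : S `<=` S' -> lift_on S' F -> lift_on S F.
Proof.
move=> SS' [hF cF]; split=> [x /SS'/hF//|x Sx e e0].
have [d d0 dF] := cF x (SS' _ Sx) e e0.
by exists d => // y /SS'; exact: dF.
Qed.

Lemma lift_on_act S m F : lift_on S F -> lift_on S (act B m \o F).
Proof.
move=> [hF cF]; split=> [x Sx|x Sx e e0]; first by rewrite bott_param_act hF.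
have [d d0 dF] := cF x Sx e e0.
by exists d => // y Sy xy j; rewrite act_dist; exact: dF.
Qed.

(** Agreement is locally constant along the segment from x0 to x: while each lift moves by less than
    pi / 2, agreement at one parameter puts the two values at the other, which share a fibre, within
    pi of each other. *)
Lemma lift_on_unique S F1 F2 x0 x : convex_in S -> lift_on S F1 -> lift_on S F2 ->
  S x0 -> S x -> F1 x0 = F2 x0 -> F1 x = F2 x.
Proof.
move=> cS [h1 c1] [h2 c2] Sx0 Sx F0.
pose g (t : R) := x0 + t *: (x - x0).
have gE s t j : g s 0 j - g t 0 j = (s - t) * (x - x0) 0 j by rewrite !mxE; ring.
suff : F1 (g 1) = F2 (g 1) by rewrite /g scale1r addrC subrK.
apply: (@segment_constant _ (fun t => F1 (g t) = F2 (g t))); last first.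
  by rewrite /g scale0r addr0.
move=> t tI; have Sg s : 0 <= s <= 1 -> S (g s) by move=> sI; exact: cS.
have pi2 : 0 < pi / 2 :> R by rewrite divr_gt0 ?pi_gt0.
have [d1 d10 e1] := c1 _ (Sg t tI) _ pi2.
have [d2 d20 e2] := c2 _ (Sg t tI) _ pi2.
have [M M0 xM] := near_by_bound (x - x0).
exists (Num.min d1 d2 / M); first by rewrite divr_gt0 // lt_min d10.
move=> s sI ts.
have gts : near_by (Num.min d1 d2) (g t) (g s).
  move=> j; rewrite gE normrM -[ltRHS](divfK (lt0r_neq0 M0)).
  by rewrite ltr_pM // ?xM.
have n1 : near_by (pi / 2) (F1 (g t)) (F1 (g s)).
  by apply: e1 (Sg s sI) _; apply: near_byW gts; rewrite ge_min lexx.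
have n2 : near_by (pi / 2) (F2 (g t)) (F2 (g s)).
  by apply: e2 (Sg s sI) _; apply: near_byW gts; rewrite ge_min lexx orbT.
have hs : bott_param B (F1 (g s)) = bott_param B (F2 (g s)) by rewrite h1 ?h2 //;
  exact: Sg.
have ht : bott_param B (F1 (g t)) = bott_param B (F2 (g t)) by rewrite h1 ?h2 //;
  exact: Sg.
split=> E; [apply: (bott_param_near ht)|apply: (bott_param_near hs)];
  rewrite [X in near_by X]splitr.
  by apply: (near_by_triangle n1); rewrite E; exact: near_by_sym.
by apply: (near_by_triangle (near_by_sym n1)); rewrite E.
Qed.

Lemma lift_on_through S F x0 y0 : lift_on S F -> S x0 -> bott_param B y0 = h x0 ->
  exists2 F', lift_on S F' & F' x0 = y0.
Proof.
move=> LF Sx0; rewrite -LF.1 // => /esym/bott_paramP[m ->].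
by exists (act B m \o F) => //; exact: lift_on_act.
Qed.

Definition liftable S := exists F, lift_on S F.

(** On the slice x_i = c the two lifts take values in the same fibres. The slice is convex, so a
    group element that makes them agree at one point of it makes them agree on all of it, and the
    halves glue. If the slice misses S, nothing has to be matched. *)
Lemma liftable_halves S i (c : R) : convex_in S ->
  liftable (S `&` [set x | x 0 i <= c]) -> liftable (S `&` [set x | c <= x 0 i]) ->
  liftable S.
Proof.
move=> cS [F1 L1] [F2 L2].
have [F3 L3 F13] : exists2 F3, lift_on (S `&` [set x | c <= x 0 i]) F3 &
    forall x, S x -> x 0 i = c -> F1 x = F3 x.
  have [[z [Sz zc]]|nz] := pselect (exists z, S z /\ z 0 i = c); last first.
    by exists F2 => // x Sx xc; case: nz; exists x.
  have [||F3 L3 F3z] := @lift_on_through _ F2 z (F1 z) L2; rewrite ?L1.1 //=.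
  - by split => //=; rewrite zc.
  - by split => //=; rewrite zc.
  exists F3 => // x Sx xc; apply:
    (@lift_on_unique (S `&` [set x | x 0 i = c]) _ _ z) => //.
  - move=> u v t [/= Su uc] [/= Sv vc] tI; split; first exact: cS.
    by rewrite /= !mxE uc vc subrr mulr0 addr0.
  - by apply: lift_onS L1 => y /= [Sy ->]; split.
  - by apply: lift_onS L3 => y /= [Sy ->]; split => /=.
pose F x := if x 0 i <= c then F1 x else F3 x.
have FE1 x : x 0 i <= c -> F x = F1 x by rewrite /F => ->.
have FE3 x : S x -> c <= x 0 i -> F x = F3 x.
  move=> Sx cx; rewrite /F; case: ifP => // xc.
  by apply: F13 => //; apply/eqP; rewrite eq_le xc.
exists F; split=> [x Sx|x Sx e e0].
  have [xc|/ltW cx] := leP (x 0 i) c; first by rewrite FE1 ?L1.1.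
  by rewrite FE3 ?L3.1.
have [d1 d10 D1] : exists2 d : R, 0 < d & forall y, S y -> y 0 i <= c ->
    near_by d x y -> near_by e (F x) (F y).
  have [xc|cx] := leP (x 0 i) c.
    have [d d0 D] := L1.2 x (conj Sx xc) e e0; exists d => // y Sy yc xy.
    by rewrite !FE1 //; apply: D.
  exists (x 0 i - c); first by rewrite subr_gt0.
  by move=> y _ yc /(_ i); rewrite ltNge; case/negP; rewrite ger0_norm; lra.
have [d2 d20 D2] : exists2 d : R, 0 < d & forall y, S y -> c <= y 0 i ->
    near_by d x y -> near_by e (F x) (F y).
  have [cx|xc] := leP c (x 0 i).
    have [d d0 D] := L3.2 x (conj Sx cx) e e0; exists d => // y Sy yc xy.
    by rewrite !FE3 //; apply: D.
  exists (c - x 0 i); first by rewrite subr_gt0.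
  by move=> y _ yc /(_ i); rewrite ltNge; case/negP; rewrite ler0_norm; lra.
exists (Num.min d1 d2); first by rewrite lt_min d10.
move=> y Sy xy; have [yc|/ltW cy] := leP (y 0 i) c.
  by apply: D1 => //; apply: near_byW xy; rewrite ge_min lexx.
by apply: D2 => //; apply: near_byW xy; rewrite ge_min lexx orbT.
Qed.

Definition box (a b : 'I_n -> R) := [set x : V | forall j, a j <= x 0 j <= b j].

Lemma convex_box a b : convex_in (box a b).
Proof.
move=> x y t Sx Sy /andP[t0 t1] j; have /andP[x1 x2] := Sx j.
have /andP[y1 y2] := Sy j; rewrite !mxE; apply/andP; split; nra.
Qed.

Lemma compact_box a b : compact (box a b).
Proof.
have := @rV_compact R n (fun j => `[a j, b j]%classic) (fun j => @segment_compact R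
  (a j) (b j)).
by congr compact; apply/seteqP; split=> x /= xab j; have := xab j; rewrite in_itv.
Qed.

Hypothesis h_loc : forall x, exists2 d : R, 0 < d & liftable [set y | near_by d x y].

(* Halving a box in one coordinate at a time reduces to boxes smaller than the
   Lebesgue number. *)
Lemma liftable_box a b : liftable (box a b).
Proof.
have liftS S S' : S `<=` S' -> liftable S' -> liftable S.
  by move=> SS' [F LF]; exists F; exact: lift_onS LF.
have [x _|d d0 dP] := @lebesgue_number R V (box a b) liftable (@compact_box a b) liftS.
  have [d d0 dP] := h_loc x; exists d => //; apply: liftS dP => y.
  by move/(ball_near_by _ _ d0).
(* [k j] is the number of halvings left for coordinate j; the induction is on their total. With none
   left all sides are at most d / 2, so the box lies in the d-ball around any of its points.
   Intersecting with [box a b] keeps that point where the Lebesgue number applies. *)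
have small (k : 'I_n -> nat) : forall a' b' : 'I_n -> R,
    (forall j, b' j - a' j <= 2 ^+ k j * (d / 2)) -> liftable (box a b `&` box a' b').
  have [c] := ubnP (\sum_j k j)%N; elim: c k => // c IH k; rewrite ltnS => kc a' b' L.
  have [i ki|k0] := pickP (fun i => 0 < k i)%N; last first.
    have [[x0 [x0a x0b]]|e] := pselect (exists x, (box a b `&` box a' b') x);
      last first.
      by exists id; split=> x Sx; case: e; exists x.
    apply: liftS (dP x0 x0a) => x [_ xb]; apply/(ball_near_by _ _ d0) => j.
    have /andP[x1 x2] := xb j; have /andP[y1 y2] := x0b j.
    have := L j; rewrite (_ : k j = 0%N) ?expr0; last by have := k0 j; lia.
    move=> Lj; rewrite ltr_norml; apply/andP; split; lra.
  pose k' j := if j == i then (k i).-1 else k j.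
  have k'c : (\sum_j k' j < c)%N.
    apply: leq_trans kc; rewrite (bigD1 i) //= [ltnRHS](bigD1 i) //= /k' eqxx.
    rewrite -addSn prednK // leq_add2l; apply: leq_sum => j /negbTE -> //.
  pose m := (a' i + b' i) / 2.
  have Li : (b' i - a' i) / 2 <= 2 ^+ (k i).-1 * (d / 2).
    by have := L i; rewrite -{1}(prednK ki) exprS; lra.
  apply: (@liftable_halves _ i m).
  - by move=> x y t [x1 x2] [y1 y2] tI; split; exact: convex_box.
  - apply: liftS (IH k' k'c a' (fun j => if j == i then m else b' j) _).
      move=> x [[xa xb] /= xm]; split => // j; have /andP[x1 x2] := xb j.
      by rewrite x1 /=; case: eqP => // ->.
    move=> j; rewrite /k'; case: eqP => [->|_]; last exact: L.
    by apply: le_trans Li; rewrite /m; lra.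
  - apply: liftS (IH k' k'c (fun j => if j == i then m else a' j) b' _).
      move=> x [[xa xb] /= xm]; split => // j; have /andP[x1 x2] := xb j.
      by rewrite x2 andbT; case: eqP => // ->.
    move=> j; rewrite /k'; case: eqP => [->|_]; last exact: L.
    by apply: le_trans Li; rewrite /m; lra.
have /choice[k kP] : forall j, exists k : nat, b j - a j <= 2 ^+ k * (d / 2).
  move=> j; pose k := Num.trunc ((b j - a j) / (d / 2)); exists k.+1.
  rewrite -ler_pdivrMr ?divr_gt0 //; apply/ltW/(lt_le_trans (truncnS_gt _)).
  by rewrite -natrX ler_nat ltnW // ltn_expl.
by apply: liftS (small k a b kP) => x; split.
Qed.

Lemma global_lift y0 : bott_param B y0 = h 0 ->
  exists2 F, lift_on setT F & F 0 = y0.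
Proof.
move=> hy0; pose K (N : nat) := box (fun=> - N%:R) (fun=> N%:R).
have K0 N : K N 0 by move=> j; rewrite mxE oppr_le0 ler0n.
have KS M N : (M <= N)%N -> K M `<=` K N.
  move=> MN x Kx j; have /andP[x1 x2] := Kx j.
  have : M%:R <= N%:R :> R by rewrite ler_nat.
  by move=> MN'; apply/andP; split; lra.
have /choice[F FP] : forall N, exists F, lift_on (K N) F /\ F 0 = y0.
  move=> N; have [F LF] := liftable_box (fun=> - N%:R) (fun=> N%:R).
  by have [F' LF' F'0] := lift_on_through LF (K0 N) hy0; exists F'.
have FE M N x : K M x -> K N x -> F M x = F N x.
  wlog MN : M N / (M <= N)%N => [W|] KM KN.
    by have [/W|/ltnW/W] := leqP M N; [exact|move=> <-].
  apply: (@lift_on_unique (K M) _ _ 0) => //; rewrite ?(FP _).2 //.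
  - exact: convex_box.
  - exact: (FP M).1.
  - by apply: lift_onS (KS _ _ MN) (FP N).1.
(* The box for x contains a whole unit neighbourhood of x, so that continuity at x can be read off
   from the single lift [F (N x)]. *)
have /choice[N NP] : forall x, exists N, forall y, near_by 1 x y -> K N y.
  move=> x; have [M M0 xM] := near_by_bound x; exists (Num.trunc (M + 1)).+1.
  move=> y xy j; have := truncnS_gt (M + 1); have := xy j; have := xM j.
  by rewrite !ltr_norml => /andP[x1 x2] /andP[y1 y2] MT; apply/andP; split; lra.
have xx x : near_by 1 x x by move=> j; rewrite subrr normr0.
have Kx x : K (N x) x by exact: NP.
exists (fun x => F (N x) x); last exact: (FP _).2.
split=> [x _|x _ e e0]; first by rewrite (FP _).1.1.
have [d d0 dF] := (FP (N x)).1.2 x (Kx x) e e0.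
exists (Num.min d 1); first by rewrite lt_min d0 ltr01.
move=> y _ xy; have xy1 : near_by 1 x y by apply: near_byW xy; rewrite ge_min lexx orbT.
rewrite (FE (N y) (N x)) //; last exact: NP.
apply: dF; first exact: NP.
by apply: near_byW xy; rewrite ge_min lexx.
Qed.

End Lift.

(** * Diffeomorphisms and equivariant bijections *)

Section Equivalence.
Local Open Scope ring_scope.
Local Open Scope classical_set_scope.
Variables (R : realType) (n : nat).
Local Notation V := 'rV[R]_n.
Implicit Types (A B : 'M[bool]_n) (m : 'rV[int]_n) (x y : V) (C : (V -> V) -> Prop).

(** The map m |-> m' is not asked to be a homomorphism; freeness of the action makes it one. *)
Definition equivariant A B (F : V -> V) :=
  forall m, exists m', forall x, F (act A m x) = act B m' (F x).

(** C is a class of maps: all maps when invariants are extracted, affine maps when diffeomorphisms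
    are built. *)
Definition bott_equiv C A B := exists F G : V -> V,
  [/\ C F, C G, cancel F G & cancel G F] /\ equivariant A B F /\ equivariant B A G.

Lemma bott_equiv_sym C A B : bott_equiv C A B -> bott_equiv C B A.
Proof. by move=> [F [G [[]]]] ? ? ? ? []; exists G, F. Qed.

Lemma bott_equiv_trans C A B D : (forall F G, C F -> C G -> C (F \o G)) ->
  bott_equiv C A B -> bott_equiv C B D -> bott_equiv C A D.
Proof.
move=> CC [F [G [[CF CG FG GF]]]] [eF eG] [F' [G' [[CF' CG' FG' GF']]]] [eF' eG'].
exists (F' \o F), (G \o G'); split; first by split; [exact: CC..|exact:
  can_comp|exact: can_comp].
split=> m.
  have [m' m'P] := eF m; have [m'' m''P] := eF' m'.
  by exists m'' => x /=; rewrite m'P m''P.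
have [m' m'P] := eG' m; have [m'' m''P] := eG m'.
by exists m'' => x /=; rewrite m'P m''P.
Qed.

Lemma bott_equivW C C' A B : (forall F, C F -> C' F) ->
  bott_equiv C A B -> bott_equiv C' A B.
Proof.
move=> CC' [F [G [[CF CG FG GF] e]]]; exists F, G; split=> //.
by split=> //; exact: CC'.
Qed.

(** The chart around the image of x may sit at another point u of the fibre of x. A group element m
    carries x to u, and [F \o act A m] is the local lift. *)
Lemma smooth_map_local A B (f : bott_manifold R A -> bott_manifold R B) x :
  smooth_map f ->
  exists2 d : R, 0 < d & liftable (f \o bott_param A) [set y | near_by d x y].
Proof.
move=> /(_ (bott_param A x))[U [W [F [[[oU _] _ [u Uu]]]]]].
move=> /esym/bott_paramP[m um] [sF _ hF].
have [d d0 dU] : exists2 d : R, 0 < d & forall y, near_by d x y -> U (act A m y).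
  have : nbhs u U by apply: open_nbhs_nbhs.
  rewrite -nbhs_ballE => -[d /= d0 dU]; exists d => // y xy.
  by apply/dU/ball_near_by => // j; rewrite um act_dist.
exists d => //; exists (F \o act A m); split=> [y /dU Uy|y /dU Uy e e0].
  by rewrite /= -hF // bott_param_act.
have /cvg_ballP/(_ e e0) := (sF 0%N).1 _ Uy.
rewrite -nbhs_ballE => -[d' /= d'0 d'F]; exists d' => // z _ yz.
apply/(ball_near_by _ _ e0)/d'F/ball_near_by => // j.
by rewrite act_dist.
Qed.

Lemma smooth_map_lift A B (f : bott_manifold R A -> bott_manifold R B) (y0 : V) :
  smooth_map f -> bott_param B y0 = f (bott_param A 0) ->
  exists2 F, lift_on (f \o bott_param A) setT F & F 0 = y0.
Proof. by move=> sf; apply: global_lift => x; exact: smooth_map_local. Qed.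

Lemma near_cont_comp (F G : V -> V) :
  near_cont setT F -> near_cont setT G -> near_cont setT (G \o F).
Proof.
move=> cF cG x _ e e0; have [d d0 dG] := cG (F x) I e e0.
have [d' d'0 d'F] := cF x I d d0; exists d' => // y _ xy.
by apply: dG => //; exact: d'F.
Qed.

Lemma act_near_cont A m : near_cont setT (act A m : V -> V).
Proof. by move=> x _ e e0; exists e => // y _ xy j; rewrite act_dist. Qed.

(** F after m and m' after F lift the same map, and m' is chosen to make them agree at 0; uniqueness
    of lifts does the rest. *)
Lemma lift_equivariant A B (f : bott_manifold R A -> bott_manifold R B) F :
  lift_on (f \o bott_param A) setT F -> equivariant A B F.
Proof.
move=> LF m.
have /bott_paramP[m' m'P] : bott_param B (F 0) = bott_param B (F (act A m 0)).
  by rewrite !LF.1 //= bott_param_act.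
exists m' => x; apply: (@lift_on_unique _ _ B (f \o bott_param A) setT
  (F \o act A m) (act B m' \o F) 0) => //.
- split=> [y _|]; first by rewrite /= LF.1 //= bott_param_act.
  exact: near_cont_comp (@act_near_cont A m) LF.2.
- exact: lift_on_act.
Qed.

Lemma diffeomorphic_equiv A B : diffeomorphic R A B -> bott_equiv (fun=> True) A B.
Proof.
move=> [f [g [fg gf sf sg]]].
have [y0 y0P] := bott_param_surj (f (bott_param A 0)).
have [F LF F0] := smooth_map_lift sf y0P.
have [x0 x0P] := bott_param_surj (g (bott_param B 0)).
have [G0 LG0 _] := smooth_map_lift sg x0P.
(* A lift of g sends y0 = F 0 somewhere in the fibre of 0. Correcting it by m gives G (F 0) = 0, so
   both composites are lifts of identities that agree with [id] at one point. *)
have /bott_paramP[m mP] : bott_param A (G0 y0) = bott_param A 0.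
  by rewrite LG0.1 //= y0P fg.
pose G := act A m \o G0; have LG := lift_on_act m LG0 : lift_on _ _ G.
have idL D : lift_on (bott_param D) setT (@id V).
  by split=> // x _ e e0; exists e.
have FG : cancel F G.
  move=> x; apply: (@lift_on_unique _ _ A (bott_param A) setT (G \o F) id 0) => //.
  - split=> [z _|]; last exact: near_cont_comp LF.2 LG.2.
    by rewrite /= LG.1 //= LF.1 //= fg.
  - by rewrite /= F0 /G /= -mP.
have GF : cancel G F.
  move=> x; apply: (@lift_on_unique _ _ B (bott_param B) setT (F \o G) id (F 0)) => //.
  - split=> [z _|]; last exact: near_cont_comp LG.2 LF.2.
    by rewrite /= LF.1 //= LG.1 //= gf.
  - by rewrite /= FG.
exists F, G; split; first by split.
by split; [exact: (lift_equivariant LF)|exact: (lift_equivariant LG)].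
Qed.

Definition affine (F : V -> V) :=
  exists (M : 'M[R]_n) (v : V), forall x, F x = x *m M + v.

Lemma affine_comp (F G : V -> V) : affine F -> affine G -> affine (F \o G).
Proof.
move=> [M [v FE]] [N [w GE]]; exists (N *m M), (w *m M + v) => x /=.
by rewrite GE FE mulmxDl mulmxA addrA.
Qed.

Lemma affine_continuous F : affine F -> continuous F.
Proof.
move=> [M [v FE]] x W /nbhs_ballP[e /= e0 eW]; apply/nbhs_ballP.
pose K := \sum_i \sum_j `|M i j| + 1.
have K0 : 0 < K by rewrite ltr_wpDl // sumr_ge0 // => i _; rewrite sumr_ge0.
exists (e / K) => /=; first exact: divr_gt0.
move=> y /(ball_near_by _ _ (divr_gt0 e0 K0)) xy; apply/eW/(ball_near_by _ _ e0) => j.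
rewrite (_ : _ - _ = \sum_i (x 0 i - y 0 i) * M i j); last first.
  by rewrite !FE !mxE opprD addrACA subrr addr0 -sumrB; apply: eq_bigr => i _;
    rewrite mulrBl.
apply: le_lt_trans (ler_norm_sum _ _ _) _.
apply: (@le_lt_trans _ _ (e / K * \sum_i \sum_j `|M i j|)).
  rewrite mulr_sumr; apply: ler_sum => i _; rewrite normrM.
  apply: ler_pM => //; first exact/ltW/xy.
  by rewrite (bigD1 j) //= lerDl sumr_ge0.
by rewrite -[ltRHS](divfK (lt0r_neq0 K0)) ltr_pM2l ?divr_gt0 // ltrDl.
Qed.

Lemma affine_derive (M : 'M[R]_n) (v u x : V) :
  (fun h : R => h^-1 *: ((h *: u + x) *m M + v - (x *m M + v))) @ 0^' --> u *m M.
Proof.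
apply: cvg_near_cst; near=> h; have h0 : h != 0 by near: h; exact: nbhs_dnbhs_neq.
rewrite mulmxDl -scalemxAl opprD addrACA subrr addr0 addrK scalerA mulVf //.
by rewrite scale1r.
Unshelve. all: by end_near. Qed.

(** The partial derivatives of an affine map are constant, hence affine, which closes the induction
    on k. *)
Lemma affine_smooth F U : affine F -> smooth_on U F.
Proof.
move=> aF k; elim: k F aF => [|k IH] F aF; first by split=> // x _; exact:
  affine_continuous.
split=> [x _|i]; first exact: affine_continuous.
have [M [v FE]] := aF; have {FE} -> : F = fun x => x *m M + v by apply/funext.
have dF x : is_derive x (delta_mx ord0 i) (fun y => y *m M + v) (delta_mx ord0 i *m M).
  have D := @affine_derive M v (delta_mx ord0 i) x.
  by apply: DeriveDef; [apply/cvg_ex; eexists; exact: D|exact: cvg_lim D].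
split=> [x _|]; first by have [] := dF x.
apply: IH; exists 0, (delta_mx ord0 i *m M) => x.
by rewrite mulmx0 add0r; have [_ ->] := dF x.
Qed.

Lemma bott_equiv_diffeomorphic A B : bott_equiv affine A B -> diffeomorphic R A B.
Proof.
move=> [F [G [[aF aG FG GF] [eF eG]]]].
have /choice[sA sAP] := @bott_param_surj R n A.
have /choice[sB sBP] := @bott_param_surj R n B.
(* The map on quotients is defined through an arbitrary section s; equivariance makes its values
   independent of s. *)
have induced A' B' (H : V -> V) (s : bott_manifold R A' -> V) :
    cancel s (bott_param A') -> equivariant A' B' H -> forall x,
    bott_param B' (H (s (bott_param A' x))) = bott_param B' (H x).
  move=> sK eH x; have /bott_paramP[m mP] := sK (bott_param A' x).
  by have [m' m'P] := eH m; rewrite [in RHS]mP m'P bott_param_act.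
have fE := induced A B F sA sAP eF; have gE := induced B A G sB sBP eG.
have pi2 : 0 < pi / 2 :> R by rewrite divr_gt0 ?pi_gt0.
(* Two points of a ball of radius pi / 2 are within pi of each other, the scale on which
   [bott_param] is injective. *)
have chart A' x : chart_domain A' (ball (x : V) (pi / 2)).
  split; first exact: ball_open.
  move=> y z /set_mem xy /set_mem xz yz; apply: (bott_param_near yz).
  rewrite [X in near_by X]splitr.
  move/(ball_near_by _ _ pi2)/near_by_sym: xy => /near_by_triangle; apply.
  exact/(ball_near_by _ _ pi2).
have chartI A' U W : open W -> chart_domain A' U -> chart_domain (R := R) A' (U `&` W).
  move=> oW [oU iU]; split; first exact: openI.
  move=> y z /set_mem[Uy _] /set_mem[Uz _]; exact: iU (mem_set Uy) (mem_set Uz).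
have smooth A' B' (H : V -> V) (s : bott_manifold R A' -> V) :
    cancel s (bott_param A') -> equivariant A' B' H -> affine H ->
    smooth_map (fun p => bott_param B' (H (s p))).
  move=> sK eH aH p; pose W := ball (H (s p)) (pi / 2).
  exists (ball (s p) (pi / 2) `&` H @^-1` W), W, H; split; split.
  - apply: chartI; last exact: chart.
    apply: open_comp; last exact: ball_open.
    by move=> x _; exact: affine_continuous.
  - exact: chart.
  - by exists (s p) => //; split; exact: ballxx.
  - exact: affine_smooth.
  - by move=> x [].
  - by move=> x _; exact: (induced A' B' H s sK eH x).
exists (fun p => bott_param B (F (sA p))), (fun p => bott_param A (G (sB p))).
split; [|move=> p; by rewrite fE GF sBP|exact: (smooth A B F sA)|exact:
  (smooth B A G sB)].
by move=> p; rewrite gE FG sAP.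
Qed.

End Equivalence.

(** * The induced map on mod 2 cohomology *)

Section Cohomology.
Local Open Scope ring_scope.
Variable n : nat.
Implicit Types (A B : 'M[bool]_n) (m : 'rV[int]_n).

Definition evec (i : 'I_n) : 'rV[int]_n := delta_mx 0 i.

Lemma bit_evec i j : bit (evec i 0 j) = (j == i)%:R.
Proof. by rewrite mxE eqxx /=; case: (j == i). Qed.

Lemma par_scale_evec A (c : int) i j : par A (c *: evec i) j = cF A i j * bit c.
Proof.
rewrite /par (bigD1 i) //= big1 ?addr0 => [|k /negbTE ki].
  by rewrite !mxE !eqxx mulr1.
by rewrite !mxE ki andbF !mulr0.
Qed.

Lemma bmul_evec A (c d : int) i :
  bmul A (c *: evec i) (d *: evec i) = (c + d) *: evec i.
Proof.
apply/rowP => j; rewrite [LHS]mxE par_scale_evec !mxE eqxx /=.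
case: eqVneq => [->|_]; last by rewrite !mulr0 addr0.
by rewrite cF_ge // mul0r sgF0 mul1r mulrDl.
Qed.

Definition character A (chi : 'rV[int]_n -> 'F_2) :=
  forall a b, chi (bmul A a b) = chi a + chi b.

(** The difference rho of the two sides is a character that vanishes on each [evec i] and on
    squares, hence on all multiples of [evec i]. Every m is a product of such multiples, split off
    one coordinate at a time. *)
Lemma characterE A chi m : character A chi ->
  chi m = \sum_i bit (m 0 i) * chi (evec i).
Proof.
move=> hchi; pose rho m := chi m + \sum_i bit (m 0 i) * chi (evec i).
have hrho : character A rho.
  move=> a b; rewrite /rho hchi addrACA -big_split /=; congr (_ + _).
  by apply: eq_bigr => i _; rewrite bit_bmul mulrDl.
have rho_even i (l : int) : rho ((l + l) *: evec i) = 0.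
  by rewrite -(bmul_evec A) hrho addFF.
have rho_evec i : rho (evec i) = 0.
  rewrite /rho (bigD1 i) //= bit_evec eqxx mul1r addrA addFF add0r big1 // => j ji.
  by rewrite bit_evec (negbTE ji) mul0r.
have rho_line i (c : int) : rho (c *: evec i) = 0.
  have [/bit0P[l ->]|c1] := F2_cases (bit c); first exact: rho_even.
  have /bit0P[l cl] : bit (c - 1) = 0 by rewrite bitD c1; apply/val_inj.
  rewrite (_ : c = 1 + (l + l)); last by rewrite -cl; ring.
  by rewrite -(bmul_evec A) hrho rho_even addr0 scale1r rho_evec.
suff /eqP : rho m = 0 by rewrite /rho addr_eq0 oppF => /eqP.
have [c] := ubnP #|[pred i | m 0 i != 0]|.
elim: c m => // c IH m; rewrite ltnS => mc.
have [i /= mi|m0] := pickP [pred i | m 0 i != 0]; last first.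
  rewrite (_ : m = 0); last by apply/rowP => i; rewrite mxE; apply/eqP/negbFE/m0.
  by rewrite -(bmul1m A 0) hrho addFF.
pose m' : 'rV[int]_n := \row_j (if j == i then 0 else m 0 j).
(* The sign in the second factor cancels the one that m' puts on coordinate i. *)
rewrite (_ : m = bmul A m' ((sgF (par A m' i) * m 0 i) *: evec i)); last first.
  apply/rowP => j; rewrite [RHS]mxE !mxE eqxx /=.
  case: eqVneq => [->|_]; last by rewrite !mulr0 addr0.
  by rewrite mulr1 add0r mulrA sgFK mul1r.
rewrite hrho rho_line addr0; apply: IH; apply: leq_trans mc.
apply: proper_card; apply/properP; split.
  by apply/fintype.subsetP => j; rewrite !inE !mxE; case: (j == i); rewrite ?eqxx.
by exists i; rewrite ?inE //= !mxE eqxx.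
Qed.

(* [m |-> m_j %/ 2] has the coboundary [(alpha_j + x_j) x_j], where [alpha_j] is
   the sign character of the j-th coordinate. *)
Lemma bit_half_bmul A a b j :
  bit (bmul A a b 0%R j %/ 2)%Z = bit (a 0%R j %/ 2)%Z + bit (b 0%R j %/ 2)%Z
                              + (par A a j + bit (a 0 j)) * bit (b 0 j).
Proof.
have half (k : int) : exists (l : int) (c : bool), k = l * 2 + c%:Z.
  exists (k %/ 2)%Z, (k != 2 * (k %/ 2)%Z).
  by have := divz_eq k 2; case: eqP => /=; lia.
have halfE (l : int) (c : bool) : ((l * 2 + c%:Z) %/ 2)%Z = l by case: c; lia.
have two (l : int) : bit (l * 2) = 0 by rewrite mulr_natr mulr2n bitD addFF.
have bitE (l : int) (c : bool) : bit (l * 2 + c%:Z) = c%:R.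
  by rewrite bitD two add0r; case: c.
rewrite mxE; have [k [c ->]] := half (a 0 j); have [l [d ->]] := half (b 0 j).
rewrite !halfE !bitE; case: (F2_cases (par A a j)) => ->.
  rewrite sgF0 mul1r.
  rewrite [X in (X %/ 2)%Z](_ : _ = (k + l + (c && d)%:Z) * 2 + (c (+) d)%:Z);
    last first.
    by case: c; case: d => /=; lia.
  by rewrite halfE !bitD; congr (_ + _); case: c; case: d; apply/val_inj.
(* With sign + the parities c and d produce a carry when c = d = 1; with sign - they produce a
   borrow when c = 0 and d = 1. *)
rewrite [X in (X %/ 2)%Z](_ :
  _ = (k - l + (~~ c && d)%:~R * -1) * 2 + (c (+) d)%:Z); last first.
  by rewrite /sgF /=; case: c; case: d => /=; lia.
rewrite halfE !bitD (_ : bit (- l) = bit l); last by rewrite /bit rmorphN oppF.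
by congr (_ + _); case: c; case: d; apply/val_inj.
Qed.

Definition cmx A : 'M['F_2]_n := \matrix_(i, j) cF A i j.

(* [P] maps the generators of H^1(M(B); F_2) to combinations of those of
   H^1(M(A); F_2) and preserves the relations [x_j ^ 2 = alpha_j x_j]. *)
Definition preserves_relations A B (P : 'M['F_2]_n) := forall (j i k : 'I_n),
  (i < k)%N ->
  let u i := P i j in let y i := (P *m (cmx B + 1%:M)) i j in
  y i * u k + y k * u i + cF A i k * (y k * u k) = 0.

(** Here x, w and z are the pullbacks along phi of x_j, alpha_j + x_j and m |-> m_j %/ 2, so z has
    coboundary w x. The identity compares the values of z on both sides of [swap], which is g_i g_k
    = g_k^(+-1) g_i. *)
Lemma hom_preserves_relations A B (phi : 'rV[int]_n -> 'rV[int]_n) :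
  (forall a b, phi (bmul A a b) = bmul B (phi a) (phi b)) ->
  preserves_relations A B (\matrix_(i, j) bit (phi (evec i) 0 j)).
Proof.
move=> hphi j i k ik u y.
pose x m := bit (phi m 0 j); pose w m := par B (phi m) j + x m.
have hx : character A x by move=> a b; rewrite /x hphi bit_bmul.
have hw : character A w by move=> a b; rewrite /w hx hphi par_bmul addrACA.
pose z m := bit (phi m 0%R j %/ 2)%Z.
have hz a b : z (bmul A a b) = z a + z b + w a * x b.
  by rewrite /z hphi bit_half_bmul.
have uE l : u l = x (evec l) by rewrite /u mxE.
have yE l : y l = w (evec l).
  rewrite /y mulmxDr mulmx1 !mxE /w /x; congr (_ + _).
  by apply: eq_bigr => r _; rewrite !mxE mulrC.
rewrite !uE !yE; have x0 : x 0 = 0 by have /eqP := hx 0 0; rewrite bmul1m addFF => /eqP.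
have w0 : w 0 = 0 by have /eqP := hw 0 0; rewrite bmul1m addFF => /eqP.
have z0 : z 0 = 0.
  by have /eqP := hz 0 0; rewrite bmul1m x0 mulr0 addr0 addFF => /eqP.
have swap : bmul A (evec i) (evec k) = bmul A (sgF (cF A i k) *: evec k) (evec i).
  apply/rowP => l; rewrite ![LHS]mxE ![RHS]mxE par_scale_evec.
  rewrite -[evec i]scale1r par_scale_evec !mxE eqxx /=.
  have nik : (i == k) = false by apply/negbTE; rewrite neq_ltn ik.
  have [->|_] := eqVneq l i.
    by rewrite nik !(cF_ge _ (leqnn i), cF_ge _ (ltnW ik)) !mul0r sgF0 /= !mulr0
      !mulr1 addr0 add0r.
  case: eqVneq => [->|_]; last by rewrite !mulr0.
  by rewrite (_ : bit 1 = 1) //= !(mulr0, mulr1) addr0 add0r.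
have := hz (evec i) (evec k); rewrite swap hz.
have wN : w (sgF (cF A i k) *: evec k) = w (evec k).
  rewrite /sgF; case: eqP => _; first by rewrite scale1r.
  apply/eqP; rewrite -subr_eq0 oppF -hw -[X in bmul _ _ X]scale1r bmul_evec.
  by rewrite addNr scale0r w0.
(* For the sign -, z of the inverse is found from z (g_k^(-1) g_k) = 0. *)
have zN : z (sgF (cF A i k) *:
  evec k) = z (evec k) + cF A i k * (w (evec k) * x (evec k)).
  have := wN; case: (F2_cases (cF A i k)) => ->; first
    by rewrite sgF0 scale1r mul0r addr0.
  rewrite mul1r => wN'; have := hz (sgF 1 *: evec k) (evec k).
  rewrite wN' -[X in bmul _ _ X]scale1r bmul_evec addNr scale0r z0 => /eqP.
  by rewrite eq_sym -addrA addr_eq0 oppF => /eqP.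
rewrite wN zN => /eqP; rewrite -subr_eq0 oppF => /eqP <-.
set zi := z (evec i); set zk := z (evec k).
rewrite [RHS](_ : _ = (zi + zi) + (zk + zk) + (w (evec i) * x (evec k) +
  w (evec k) * x (evec i) + cF A i k * (w (evec k) * x (evec k)))); last by ring.
by rewrite !addFF !add0r.
Qed.

(** The relations are imposed on P alone, so the notion is directed from A to B; distinct normal
    forms are separated in one direction or the other. *)
Definition cohomologous A B := exists P Q : 'M['F_2]_n,
  [/\ P *m Q = 1%:M, Q *m P = 1%:M & preserves_relations A B P].

(** Freeness of the action turns the correspondences of F and G into mutually inverse homomorphisms;
    by [characterE] their matrices mod 2 are then inverse to each other. *)
Lemma bott_equiv_cohomologous (R : realType) A B :
  bott_equiv (fun _ : 'rV[R]_n -> 'rV[R]_n => True) A B -> cohomologous A B.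
Proof.
move=> [F [G [[_ _ FG GF] [/choice[phi phiP] /choice[psi psiP]]]]].
have hphi a b : phi (bmul A a b) = bmul B (phi a) (phi b).
  by apply: (@act_inj R _ B _ _ (F 0)); rewrite -phiP !act_bmul !phiP.
have hpsi a b : psi (bmul B a b) = bmul A (psi a) (psi b).
  by apply: (@act_inj R _ A _ _ (G 0)); rewrite -psiP !act_bmul !psiP.
have phiK m : psi (phi m) = m.
  by apply: (@act_inj R _ A _ _ 0); rewrite -{1}(FG 0) -psiP -phiP FG.
have psiK m : phi (psi m) = m.
  by apply: (@act_inj R _ B _ _ 0); rewrite -{1}(GF 0) -phiP -psiP GF.
have inv C (f g : 'rV[int]_n -> 'rV[int]_n) D :
    (forall a b, g (bmul C a b) = bmul D (g a) (g b)) -> cancel f g ->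
    (\matrix_(i, j) bit (f (evec i) 0 j)) *m (\matrix_(i, j) bit (g (evec i) 0 j)) =
      1%:M.
  move=> hg fg; apply/matrixP => i j; rewrite !mxE.
  have hchi : character C (fun m => bit (g m 0 j)) by move=> a b; rewrite hg bit_bmul.
  rewrite -[RHS]mulr1n -[RHS](_ : bit (g (f (evec i)) 0 j) = _); last first.
    by rewrite fg bit_evec eq_sym; case: eqP.
  by rewrite (characterE _ hchi); apply: eq_bigr => l _; rewrite !mxE.
exists (\matrix_(i, j) bit (phi (evec i) 0 j)), (\matrix_(i, j) bit (psi (evec i) 0 j)).
by split; [exact: inv hpsi phiK|exact: inv hphi psiK|exact: hom_preserves_relations].
Qed.

End Cohomology.

(** * Normal forms of Bott matrices *)

Section Moves.
Local Open Scope ring_scope.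
Variables (R : realType) (n : nat).
Local Notation V := 'rV[R]_n.
Implicit Types (A B : 'M[bool]_n) (m : 'rV[int]_n) (x y : V).

Definition affine_equiv A B := bott_equiv (@affine R n) A B.

Lemma affine_equiv_sym A B : affine_equiv A B -> affine_equiv B A.
Proof. exact: bott_equiv_sym. Qed.

Lemma affine_equiv_trans A B D :
  affine_equiv A B -> affine_equiv B D -> affine_equiv A D.
Proof. exact: (bott_equiv_trans (@affine_comp R n)). Qed.

Lemma sum_delta (p : 'I_n) (f : 'I_n -> 'F_2) : \sum_i (i == p)%:R * f i = f p.
Proof.
rewrite (bigD1 p) //= eqxx mul1r big1 ?addr0 // => i /negbTE ->.
by rewrite mul0r.
Qed.

Lemma affine_equiv_perm A B (s : 'S_n) :
  (forall i j, cF A i j = cF B (s i) (s j)) -> affine_equiv A B.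
Proof.
have aff (t : 'S_n) : affine (fun x : V => \row_j x 0 (t j)).
  exists (perm_mx t^-1), 0 => x; rewrite -col_permE addr0.
  by apply/rowP => j; rewrite !mxE.
have eqv A' B' (t : 'S_n) : (forall i j, cF A' i j = cF B' (t i) (t j)) ->
    equivariant A' B' (fun x : V => \row_j x 0 (t^-1 j)%g).
  move=> AB m; exists (\row_j m 0 (t^-1 j)%g) => x; apply/rowP => j; rewrite !mxE.
  congr ((sgF _)%:~R * _ + _); rewrite /par [RHS](reindex_inj (@perm_inj _ t)) /=.
  by apply: eq_bigr => i _; rewrite mxE permK AB permKV.
move=> AB; exists (fun x => \row_j x 0 (s^-1 j)%g), (fun x => \row_j x 0 (s j)).
split; first by split=> // x; apply/rowP => j; rewrite !mxE ?permK ?permKV.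
split; first exact: eqv.
have := eqv B A s^-1%g; rewrite invgK; apply=> i j.
by rewrite AB !permKV.
Qed.

Lemma affine_equiv_refl A B : (forall i j, cF A i j = cF B i j) -> affine_equiv A B.
Proof. by move=> AB; apply: (@affine_equiv_perm _ _ 1%g) => i j; rewrite !perm1. Qed.

(* The change of basis [g_p := g_p g_q] of the group. *)
Lemma affine_equiv_add A B (p q : 'I_n) : p != q ->
  (forall i, cF A i p = 0) -> (forall i, cF A i q = 0) ->
  (forall i j, cF B i j = cF A i j + (i == p)%:R * cF A q j) -> affine_equiv A B.
Proof.
move=> pq Ap Aq AB.
have qp : (q == p) = false by rewrite eq_sym (negbTE pq).
(* The elements act on coordinates p and q by translations, so this shear adds c m_p to m_q.
   Allowing any odd c covers the inverse shear, c = -1, by the same computation. *)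
pose F (c : int) x : V := \row_j (x 0 j + (j == q)%:R * c%:~R * x 0 p).
have aff c : affine (F c).
  exists (1%:M + c%:~R *: delta_mx p q), 0 => x; apply/rowP => j.
  rewrite addr0 mulmxDr mulmx1 -scalemxAr !mxE; congr (_ + _).
  rewrite (bigD1 p) //= big1 => [|i /negbTE ip]; last by rewrite !mxE ip mulr0.
  by rewrite !mxE eqxx /= addr0; ring.
have FK c : cancel (F c) (F (- c)).
  move=> x; apply/rowP => j; rewrite !mxE (negbTE pq) mul0r mul0r addr0.
  by rewrite rmorphN /=; ring.
have eqv A' B' c : bit c = 1 -> (forall i, cF A' i p = 0) ->
  (forall i, cF A' i q = 0) ->
    (forall i j, cF B' i j = cF A' i j + (i == p)%:R * cF A' q j) ->
    equivariant A' B' (F c).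
  move=> c1 A'p A'q A'B' m.
  pose m' : 'rV[int]_n := \row_j (m 0 j + (j == q)%:R * c * m 0 p).
  have parE j : par B' m' j = par A' m j.
    have bitE i : bit (m' 0 i) = bit (m 0 i) + (i == q)%:R * bit (m 0 p).
      rewrite mxE bitD; congr (_ + _); case: eqP => _; rewrite ?mul0r // !mul1r.
      by rewrite /bit rmorphM /= -!/(bit _) c1 mul1r.
    rewrite /par (eq_bigr (fun i => cF A' i j * bit (m 0 i) +
      ((i == q)%:R * (cF A' i j * bit (m 0 p)) +
       (i == p)%:R * (cF A' q j * (bit (m 0 i) + (i == q)%:R * bit (m 0 p)))))).
      rewrite !big_split /= !sum_delta (negbTE pq) mul0r addr0.
      by rewrite addFF addr0.
    by move=> i _; rewrite A'B' bitE; ring.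
  exists m' => x; apply/rowP => j; rewrite !mxE parE.
  rewrite rmorphD !rmorphM /=; case: eqVneq => [->|_] /=; last by ring.
  rewrite (_ : par A' m q = 0); last by apply: big1 => i _; rewrite A'q mul0r.
  rewrite (_ : par A' m p = 0); last by apply: big1 => i _; rewrite A'p mul0r.
  by rewrite sgF0; ring.
exists (F 1), (F (-1)); split; first by split=> //; have := FK (-1); rewrite opprK.
split; first exact: eqv.
apply: eqv => [|i|i|i j]; first exact/val_inj.
all: rewrite !AB ?Ap ?Aq ?qp ?mul0r ?mulr0 ?addr0 //.
by rewrite -addrA addFF addr0.
Qed.

(* A quarter turn of the j-th coordinate. *)
Lemma affine_equiv_quarter A B (j l : 'I_n) :
  (forall k, cF A j k = (k == l)%:R) ->
  (forall i k, cF B i k = cF A i k + (k == l)%:R * cF A i j) -> affine_equiv A B.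
Proof.
move=> Aj AB; have lj : (j == l) = false.
  by apply/negbTE; apply/eqP => e; have := Aj l; rewrite eqxx -{1}e cF_ge.
pose F (c : R) x : V := \row_k (x 0 k + (k == j)%:R * c).
have aff c : affine (F c).
  exists 1%:M, (\row_k ((k == j)%:R * c)) => x; apply/rowP => k.
  by rewrite mulmx1 !mxE.
have FK c : cancel (F c) (F (- c)).
  by move=> x; apply/rowP => k; rewrite !mxE; ring.
have eqv A' B' (c : int) : bit c = 1 -> (forall k, cF A' j k = (k == l)%:R) ->
    (forall i k, cF B' i k = cF A' i k + (k == l)%:R * cF A' i j) ->
    equivariant A' B' (F (c%:~R * (pi / 2))).
  move=> c1 A'j A'B' m.
  (* Conjugating a reflection of coordinate j by the shift c pi / 2 adds c pi to its translation
     part. The resulting change of parity of m_j affects only the sign at l, as row j has no other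
     off-diagonal entry; the new column l compensates. *)
  pose d : int := if par A' m j == 0 then 0 else c.
  have bd : bit d = par A' m j.
    by rewrite /d; case: (F2_cases (par A' m j)) => -> //.
  pose m' : 'rV[int]_n := \row_k (m 0 k + (k == j)%:R * d).
  have parE k : par B' m' k = par A' m k.
    have bitE i : bit (m' 0 i) = bit (m 0 i) + (i == j)%:R * par A' m j.
      by rewrite mxE bitD -bd; case: eqP => _; rewrite ?mul0r ?mul1r.
    rewrite /par (eq_bigr (fun i => cF A' i k * bit (m 0 i) +
      ((i == j)%:R * (cF A' i k * par A' m j) +
       ((k == l)%:R * (cF A' i j * bit (m 0 i)) +
        (i == j)%:R * ((k == l)%:R * (cF A' i j * par A' m j)))))).
      rewrite !big_split /= !sum_delta -mulr_sumr -/(par A' m j) A'j.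
      by rewrite [cF A' j j]cF_ge // mul0r mulr0 addr0 addFF addr0.
    by move=> i _; rewrite A'B' bitE; ring.
  exists m' => x; apply/rowP => k; rewrite !mxE parE.
  rewrite rmorphD !rmorphM /=; case: eqVneq => [->|_] /=; last by ring.
  by rewrite /d /sgF; case: ifP => _; lra.
pose h : R := pi / 2.
exists (F h), (F (- h)); split.
  by split=> //; have := FK (- h); rewrite opprK.
split; first by have := eqv A B 1 erefl Aj AB; rewrite mul1r.
rewrite (_ : - h = (-1)%:~R * (pi / 2)); last by rewrite mulN1r.
apply: eqv => [|k|i k]; first exact/val_inj.
  by rewrite AB Aj [cF A j j]cF_ge // mulr0 addr0.
by rewrite !AB [j == l]lj mul0r addr0 -addrA addFF addr0.
Qed.

End Moves.

(** * Reduction to 32 states and to six normal forms *)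

Section NormalForms.
Local Open Scope ring_scope.
Variables (R : realType) (m : nat).
Hypothesis m2 : (2 <= m)%N.
Local Notation ord := 'I_(m.+2).
Implicit Types (w : nat -> bool * bool) (e : bool).

Definition addp (a b : bool * bool) := (a.1 (+) b.1, a.2 (+) b.2).

(* Only the last two columns are nontrivial: the i-th row, i < m, ends with
   [w i], and [e] is the entry at (m, m + 1). *)
Definition off_diag w e (i j : nat) : bool :=
  if j == m then (i < m)%N && (w i).1
  else (j == m.+1) && (if (i < m)%N then (w i).2 else (i == m) && e).

Definition two_column_mx w e : 'M[bool]_(m.+2) :=
  \matrix_(i, j) ((i == j) || off_diag w e i j).

Lemma off_diag_lt w e i j : off_diag w e i j -> (i < j)%N.
Proof.
rewrite /off_diag; case: (j =P m) => [-> /andP[]//|_].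
case: (j =P m.+1) => [->|//] /=.
by case: ltnP => [/ltnW im _|_ /andP[/eqP -> _]]; rewrite ltnS.
Qed.

Lemma cF_two_column w e (i j : ord) :
  cF (two_column_mx w e) i j = (off_diag w e i j)%:R.
Proof.
rewrite /cF mxE; congr (nat_of_bool _)%:R; have := @off_diag_lt w e i j.
case: (off_diag w e i j) => [->//|_]; rewrite ?orbT //= orbF.
by case: eqP => [->|]; rewrite ?ltnn ?andbF.
Qed.

Lemma addbR (x y : bool) : (x (+) y)%:R = x%:R + y%:R :> 'F_2.
Proof. by case: x; case: y; apply/val_inj. Qed.

Definition reach w w' := forall e, affine_equiv R (two_column_mx w e) (two_column_mx
  w' e).

Lemma reach_eq w w' : (forall i, (i < m)%N -> w i = w' i) -> reach w w'.
Proof.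
move=> ww' e; apply: affine_equiv_refl => i j; rewrite !cF_two_column /off_diag.
by case: (ltnP i m) => // im; rewrite ww'.
Qed.

Lemma reach_trans w1 w2 w3 : reach w1 w2 -> reach w2 w3 -> reach w1 w3.
Proof. by move=> h12 h23 e; exact: affine_equiv_trans (h12 e) (h23 e). Qed.

Definition upd w (p q : nat) := fun i => if i == p then addp (w p) (w q) else w i.

Lemma reach_upd w p q : (p < m)%N -> (q < m)%N -> p != q -> reach w (upd w p q).
Proof.
move=> pm qm pq e.
have pn : (p < m.+2)%N by lia.
have qn : (q < m.+2)%N by lia.
have triv w' r i : (r < m)%N -> off_diag w' e i r = false.
  by move=> rm; rewrite /off_diag (ltn_eqF rm) (ltn_eqF (ltnW rm : (r < m.+1)%N)).
apply: (@affine_equiv_add R _ _ _ (Ordinal pn) (Ordinal qn)) => //.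
- by move=> i; rewrite cF_two_column triv.
- by move=> i; rewrite cF_two_column triv.
move=> i j; rewrite !cF_two_column /off_diag /= -val_eqE /= /upd qm.
case: (eqVneq (i : nat) p) => [->|_]; last by rewrite mul0r addr0.
rewrite pm mul1r; case: eqP => _ /=; [|case: eqP => _ /=].
- exact: addbR.
- exact: addbR.
- by rewrite addr0.
Qed.

(** Rows 0, 1 and c are three vectors of F_2^2, hence dependent. Either row c is a combination of
    rows 0 and 1 and is cleared by adding them, or rows 0 and 1 are dependent: one of them is made
    zero, receives row c and then clears it. *)
Lemma clear_row w c : (2 <= c < m)%N ->
  exists w', [/\ reach w w', w' c = (false, false) &
  forall i, (2 <= i)%N -> i != c -> w' i = w i].
Proof.
move=> /andP[c2 cm].
pose P w := exists w', [/\ reach w w', w' c = (false, false) &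
  forall i, (2 <= i)%N -> i != c -> w' i = w i].
have P0 v : v c = (false, false) -> P v by move=> vc; exists v; split=> //; exact:
  reach_eq.
have Pstep v p q : (p < 2)%N || (p == c) -> (q < 2)%N || (q == c) -> p != q ->
    P (upd v p q) -> P v.
  move=> pc qc pq [w' [rw w'c w'E]]; exists w'; split=> // [|i i2 ic].
    by apply: reach_trans rw; apply: reach_upd => //; lia.
  by rewrite w'E // /upd ifN //; lia.
have c0 : (c == 0)%N = false by lia.
have c1 : (c == 1)%N = false by lia.
have zc : (0 == c)%N = false by lia.
have oc : (1 == c)%N = false by lia.
rewrite -/(P w).
have S0 v : v c = v 0 -> P v.
  move=> vc; apply: (Pstep v c 0) => //; rewrite ?eqxx ?orbT ?c0 //.
  by apply: P0; rewrite /upd eqxx vc /addp !addbb.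
have S1 v : v c = v 1 -> P v.
  move=> vc; apply: (Pstep v c 1) => //; rewrite ?eqxx ?orbT ?c1 //.
  by apply: P0; rewrite /upd eqxx vc /addp !addbb.
have S01 v : v c = addp (v 0) (v 1) -> P v.
  move=> vc; apply: (Pstep v c 0) => //; rewrite ?eqxx ?orbT ?c0 //.
  apply: S1; rewrite /upd eqxx oc vc /addp.
  by case: (v 0) (v 1) => [[] []] [[] []].
have Z0 v : v 0 = (false, false) -> P v.
  move=> v0; apply: (Pstep v 0 c) => //; rewrite ?eqxx ?orbT ?zc //.
  by apply: S0; rewrite /upd eqxx c0 v0 /addp; case: (v c) => [] [] [].
have Z1 v : v 1 = (false, false) -> P v.
  move=> v0; apply: (Pstep v 1 c) => //; rewrite ?eqxx ?orbT ?oc //.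
  by apply: S1; rewrite /upd eqxx c1 v0 /addp; case: (v c) => [] [] [].
have E01 v : v 0 = v 1 -> P v.
  move=> v01; apply: (Pstep v 1 0) => //; apply: Z1.
  by rewrite /upd eqxx v01 /addp !addbb.
have [/S0//|/eqP n0] := eqVneq (w c) (w 0).
have [/S1//|/eqP n1] := eqVneq (w c) (w 1).
have [/S01//|/eqP n01] := eqVneq (w c) (addp (w 0) (w 1)).
have [/Z0//|/eqP z0] := eqVneq (w 0) (false, false).
have [/Z1//|/eqP z1] := eqVneq (w 1) (false, false).
have [/E01//|/eqP e01] := eqVneq (w 0) (w 1).
have [z|/eqP zz] := eqVneq (w c) (false, false); first exact: P0.
move: n0 n1 n01 z0 z1 e01 zz; rewrite /addp.
by case: (w 0) (w 1) (w c) => [[] []] [[] []] [[] []].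
Qed.

Definition first_two (a b : bool * bool) i :=
  if i is i'.+1 then (if i' is 0 then b else (false, false)) else a.

Lemma reach_first_two w : exists a b, reach w (first_two a b).
Proof.
have [w' [rw w'0]] : exists w', reach w w' /\
    forall i, (i < m)%N -> (2 <= i)%N -> (i < m)%N -> w' i = (false, false).
  elim: {1}m => [|k [w' [rw w'0]]]; first by exists w; split=> //; exact: reach_eq.
  have [km|km] := boolP (2 <= k < m)%N; last first.
    by exists w'; split=> // i ik i2 im; apply: w'0 => //; lia.
  have [w'' [rw' w''k w''E]] := clear_row w' km.
  exists w''; split; first exact: reach_trans rw'.
  move=> i ik i2 im; have [->//|ik'] := eqVneq i k.
  by rewrite w''E // w'0 //; lia.
exists (w' 0%N), (w' 1%N); apply: reach_trans rw _; apply: reach_eq.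
by move=> [|[|i]] im //=; rewrite w'0.
Qed.

(** Rows 0 and 1 in the last two columns, and the entry joining these columns. *)
Definition state := ((bool * bool) * (bool * bool) * bool)%type.

Definition state_mx (s : state) := two_column_mx (first_two s.1.1 s.1.2) s.2.

Local Notation steps s t := (affine_equiv R (state_mx s) (state_mx t)).

Lemma step_add01 a b e : steps (a, b, e) (addp a b, b, e).
Proof.
have h : reach (first_two a b) (upd (first_two a b) 0 1) by apply: reach_upd; lia.
apply: affine_equiv_trans (h e) _.
by apply: reach_eq => -[|[|i]] _.
Qed.

Lemma step_add10 a b e : steps (a, b, e) (a, addp b a, e).
Proof.
have h : reach (first_two a b) (upd (first_two a b) 1 0) by apply: reach_upd; lia.
apply: affine_equiv_trans (h e) _.
by apply: reach_eq => -[|[|i]] _.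
Qed.

Definition shear (a : bool * bool) := (a.1, a.2 (+) a.1).

(** Row m has a single off-diagonal entry, in the last column, so a quarter turn of coordinate m
    adds column m to column m + 1. *)
Lemma step_shear a b : steps (a, b, true) (shear a, shear b, true).
Proof.
have mn : (m < m.+2)%N by lia.
have ln : (m.+1 < m.+2)%N by lia.
apply: (@affine_equiv_quarter R _ _ _ (Ordinal mn) (Ordinal ln)) => [k|i k].
  rewrite cF_two_column /off_diag -val_eqE /= ltnn eqxx /=.
  by case: (eqVneq (k : nat) m) => [->|_]; [rewrite ltn_eqF|rewrite andbT].
rewrite !cF_two_column /off_diag -val_eqE /= eqxx.
have [->|km] := eqVneq (k : nat) m.
  rewrite ltn_eqF // mul0r addr0; case: (ltnP i m) => //= _.
  by case: (val i) => [|[|]].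
case: (eqVneq (k : nat) m.+1) => [_|]; last by rewrite mul0r addr0.
rewrite mul1r; case: ltnP => im /=; last by rewrite addr0.
by rewrite -addbR; case: (val i) => [|[|]].
Qed.

Definition swapp (a : bool * bool) := (a.2, a.1).

Lemma val_tperm (i x y : ord) : tperm x y i =
  (if i == x :> nat then y : nat else if i == y :> nat then x : nat else i) :> nat.
Proof.
case: tpermP => [->|->|]; rewrite ?eqxx //; first by case: eqP.
by move=> /eqP/negbTE ix /eqP/negbTE iy; rewrite !val_eqE ix iy.
Qed.

Lemma step_swap a b : steps (a, b, false) (swapp a, swapp b, false).
Proof.
have mn : (m < m.+2)%N by lia.
have ln : (m.+1 < m.+2)%N by lia.
apply: (@affine_equiv_perm R _ _ _ (tperm (Ordinal mn) (Ordinal ln))) => i j.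
rewrite !cF_two_column /off_diag !val_tperm /=; congr (nat_of_bool _)%:R.
have lm : (m.+1 < m)%N = false by lia.
have ml : (m == m.+1)%N = false by lia.
have lm' : (m.+1 == m)%N = false by lia.
have swE k : (first_two (swapp a) (swapp b) k).1 = (first_two a b k).2 by case:
  k => [|[]].
have swE' k : (first_two (swapp a) (swapp b) k).2 = (first_two a b k).1 by case:
  k => [|[]].
move: (nat_of_ord i) (nat_of_ord j) => {}i {}j.
case: (j =P m) => [_|jm].
  rewrite eqxx lm' /=; case: (i =P m) => [im|_]; first by rewrite ?im ?ltnn ?lm ?andbF.
  case: (i =P m.+1) => [im|_]; first by rewrite ?im ?ltnn ?lm ?andbF.
  by rewrite swE'; case: ltnP => //; rewrite andbF.
case: (j =P m.+1) => [_|jl].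
  rewrite eqxx /=; case: (i =P m) => [im|_]; first by rewrite ?im ?ltnn ?lm.
  case: (i =P m.+1) => [im|_]; first by rewrite ?im ?ltnn ?lm ?andbF.
  by rewrite swE; case: ltnP => //; rewrite andbF.
by move/eqP/negbTE: jm => ->; move/eqP/negbTE: jl => ->.
Qed.

(** Column m is trivial here, so row m may also be changed: adding row 0, which ends with (0, 1),
    clears the joining entry. *)
Lemma step_zero1 (a b : bool * bool) : a.1 = false -> b.1 = false -> a.2 ->
  steps (a, b, true) (a, b, false).
Proof.
move=> a1 b1 a2; have mn : (m < m.+2)%N by lia.
apply: (@affine_equiv_add R _ _ _ (Ordinal mn) ord0).
- by rewrite -val_eqE /=; lia.
- move=> i; rewrite cF_two_column /off_diag /= eqxx.
  rewrite (_ : (_ && _) = false) //.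
  by case: (nat_of_ord i) => [|[|k]]; rewrite /= ?a1 ?b1 andbF.
- by move=> i; rewrite cF_two_column /off_diag /= ltn_eqF //; lia.
move=> i j; rewrite !cF_two_column /off_diag -val_eqE /= (ltnW m2 : (0 < m)%N) /=.
have [->|im] := eqVneq (i : nat) m; last first.
  by rewrite mul0r addr0; case: ifP => // _; case: ltnP.
rewrite ltnn mul1r /= andbF a1 a2; case: ifP => _; first by rewrite addr0.
by case: (j == m.+1 :> nat); apply/val_inj.
Qed.

Lemma step_zero : steps ((false, false), (false, false), true)
  ((false, true), (false, false), false).
Proof.
have mn : (m < m.+2)%N by lia.
apply: (@affine_equiv_perm R _ _ _ (tperm (Ordinal mn) ord0)) => i j.
rewrite !cF_two_column /off_diag !val_tperm /=; congr (nat_of_bool _)%:R.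
have m0 : (m == 0)%N = false by lia.
have m0' : (0 == m)%N = false by lia.
have mp : (0 < m)%N by lia.
have lm : (m.+1 == m)%N = false by lia.
have z1 k : (first_two (false, false) (false, false) k).1 = false by case: k => [|[]].
have z2 k : (first_two (false, false) (false, false) k).2 = false by case: k => [|[]].
have z3 k : (first_two (false, true) (false, false) k).1 = false by case: k => [|[]].
have z4 k : (first_two (false, true) (false, false) k).2 = (k == 0)%N by case:
  k => [|[]].
move: (nat_of_ord i) (nat_of_ord j) => {}i {}j; rewrite !z1 !z2 !z3 !z4 !andbF.
case: (j =P m) => [jm|jm]; first by rewrite m0'.
case: (j =P m.+1) => [jl|jl] /=; last first.
  by case: (j =P 0%N) => [_|j0]; rewrite ?eqxx //; move/eqP/negbTE: jm => ->;
    move/eqP/negbTE: jl => ->.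
rewrite jl /= lm eqxx /=.
case: (i =P m) => [im|im]; first by rewrite im ltnn mp.
case: (i =P 0%N) => [i0|i0]; first by rewrite ?i0 ?mp ?ltnn ?andbF ?m0 ?m0'.
by case: ifP => //; move/eqP/negbTE: i0 => ->.
Qed.

(** A reduction strategy in which every branch is one of the moves above or rests; its fixed points
    are exactly [normal_states]. *)
Definition next (s : state) : state :=
  let: (a, b, e) := s in
  if a == (false, false) then
    if b == (false, false) then if e then ((false, true), (false, false), false) else s
    else (addp a b, b, e)
  else if a == b then (a, addp b a, e)
  else if b == (false, false) then
    if e then
      if a.1 then if a.2 then (shear a, shear b, e) else s else (a, b, false)
    else if a == (false, true) then (swapp a, swapp b, e) else s
  else if (a.1 && ~~ a.2) || b.1 && ~~ b.2 then
    if b == (false, true) then s else (a, addp b a, e)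
  else (addp a b, b, e).

(** Up to torus factors: the torus; the Klein bottle K; the orientable flat 3-manifold with holonomy
    of order 2; K x K; the 3-dimensional form with signs x_0 and x_m; the 4-dimensional form with
    signs x_0 and x_1 + x_m. *)
Definition normal_states : seq state :=
  [:: ((false, false), (false, false), false);
      ((true, false), (false, false), false);
      ((true, true), (false, false), false);
      ((true, false), (false, true), false);
      ((true, false), (false, false), true);
      ((true, false), (false, true), true)].

Lemma step_next s : steps s (next s).
Proof.
case: s => [[a b] e]; rewrite /next.
have refl s : steps s s by exact: affine_equiv_refl.
case: eqP => [->|a0].
  case: eqP => [->|_]; last exact: step_add01.
  by case: e => //; exact: step_zero.
case: eqP => [_|ab]; first exact: step_add10.
case: (b =P _) => [b0|_].
  case: e; last by case: eqP => // _; exact: step_swap.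
  case a1 : a.1; first by case: a.2 => //; exact: step_shear.
  apply: step_zero1; rewrite ?b0 //.
  by move: a a0 a1 {ab} => [[] []].
case: ifP => _; last exact: step_add01.
by case: eqP => // _; exact: step_add10.
Qed.

Lemma normal_next s : iter 8 next s \in normal_states.
(* Evaluation on all 32 states shows that eight steps suffice. *)
Proof. by case: s => [[[[] []] [[] []]] []]; vm_compute. Qed.

Lemma affine_equiv_normal w e : exists2 s, s \in normal_states &
  affine_equiv R (two_column_mx w e) (state_mx s).
Proof.
have [a [b wab]] := reach_first_two w.
exists (iter 8 next (a, b, e)); first exact: normal_next.
apply: affine_equiv_trans (wab e) _; rewrite -[two_column_mx _ _]/(state_mx (a, b, e)).
elim: 8%N => [|k IH]; first exact: affine_equiv_refl.
by rewrite iterS; exact: affine_equiv_trans IH (step_next _).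
Qed.

End NormalForms.

(** * Distinguishing the normal forms *)

Section Distinguish.
Local Open Scope ring_scope.
Variable m : nat.
Hypothesis m2 : (2 <= m)%N.
Local Notation ord := 'I_(m.+2).
Local Notation oZ0 := (inord 0 : ord).
Local Notation oZ1 := (inord 1 : ord).
Local Notation oJ := (inord m : ord).
Local Notation oL := (inord m.+1 : ord).
Implicit Types (s t : state) (P Q : 'M['F_2]_(m.+2)).

Let vZ0 : oZ0 = 0%N :> nat. Proof. by rewrite inordK. Qed.
Let vZ1 : oZ1 = 1%N :> nat. Proof. by rewrite inordK. Qed.
Let vJ : oJ = m :> nat. Proof. by rewrite inordK. Qed.
Let vL : oL = m.+1 :> nat. Proof. by rewrite inordK. Qed.

Lemma mulF_eq1 (x y : 'F_2) : x * y = 1 -> x = 1 /\ y = 1.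
Proof. by case: (F2_cases x) => ->; case: (F2_cases y) => ->. Qed.

Lemma cF_state_lt s (i j : ord) : (j < m)%N -> cF (state_mx m s) i j = 0.
Proof. by move=> jm; rewrite cF_two_column /off_diag (ltn_eqF jm) (ltn_eqF (ltnW jm :
  (j < m.+1)%N)). Qed.

Lemma cF_state_J s (i : ord) : cF (state_mx m s) i oJ =
  (i == oZ0)%:R * s.1.1.1%:R + (i == oZ1)%:R * s.1.2.1%:R.
Proof.
rewrite cF_two_column /off_diag -!val_eqE /= vZ0 vZ1 vJ eqxx.
case: (nat_of_ord i) => [|[|k]] /=; rewrite ?mul1r ?mul0r ?addr0 ?add0r ?andbF //.
  by rewrite (ltnW m2).
by rewrite m2.
Qed.

Lemma cF_state_L s (i : ord) : cF (state_mx m s) i oL =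
  (i == oZ0)%:R * s.1.1.2%:R + (i == oZ1)%:R * s.1.2.2%:R + (i == oJ)%:R * s.2%:R.
Proof.
rewrite cF_two_column /off_diag -!val_eqE /= vZ0 vZ1 vJ vL eqxx gtn_eqF //=.
have [im|im] := ltnP i m.
  rewrite (ltn_eqF im) mul0r addr0; move: im.
  by case: (nat_of_ord i) => [|[|k]] _ /=; rewrite ?mul1r ?mul0r ?addr0 ?add0r.
have i0 : (i == 0 :> nat) = false by lia.
have i1 : (i == 1 :> nat) = false by lia.
rewrite i0 i1 !mul0r !add0r; case: eqP => _; by rewrite ?mul1r ?mul0r.
Qed.

(** For a trivial column j of t, y = u: the first two terms of the relation cancel and u_k^2 = u_k
    remains. *)
Lemma state_trivial_column P s t (i j k : ord) :
  preserves_relations (state_mx m s) (state_mx m t) P ->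
  (forall r, cF (state_mx m t) r j = 0) -> cF (state_mx m s) i k = 1 -> P k j = 0.
Proof.
move=> H tj sik; have ik : (i < k)%N.
  by rewrite ltnNge; apply/negP => ki; move: sik; rewrite cF_ge.
have yj l : (P *m (cmx (state_mx m t) + 1%:M)) l j = P l j.
  rewrite mulmxDr mulmx1 [LHS]mxE mxE big1 ?add0r // => r _.
  by rewrite mxE tj mulr0.
have := H j i k ik; rewrite /= !yj sik mul1r [P k j * P i j]mulrC addFF add0r.
by case: (F2_cases (P k j)) => ->.
Qed.

Lemma mulmx_two P Q (k l : ord) :
  (forall j : ord, (j < m)%N -> P k j = 0) ->
  (P *m Q) k l = P k oJ * Q oJ l + P k oL * Q oL l.
Proof.
move=> Pk; have LJ : oL != oJ by rewrite -val_eqE /= vL vJ gtn_eqF.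
rewrite mxE (bigD1 oJ) //= (bigD1 oL) //= big1 ?addr0 // => j /andP[jJ jL].
rewrite Pk ?mul0r //; move: jJ jL; rewrite -!val_eqE /= vJ vL.
by have := ltn_ord j; lia.
Qed.

Lemma y_J P t i : (P *m (cmx (state_mx m t) + 1%:M)) i oJ =
  P i oJ + (P i oZ0 * t.1.1.1%:R + P i oZ1 * t.1.2.1%:R).
Proof.
rewrite mulmxDr mulmx1 !mxE addrC; congr (_ + _).
under eq_bigr => r _ do rewrite mxE cF_state_J mulrDr !(mulrCA (P i r)).
by rewrite big_split /= !sum_delta.
Qed.

Lemma y_L P t i : (P *m (cmx (state_mx m t) + 1%:M)) i oL =
  P i oL + (P i oZ0 * t.1.1.2%:R + P i oZ1 * t.1.2.2%:R + P i oJ * t.2%:R).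
Proof.
rewrite mulmxDr mulmx1 !mxE addrC; congr (_ + _).
under eq_bigr => r _ do rewrite mxE cF_state_L !mulrDr !(mulrCA (P i r)).
by rewrite !big_split /= !sum_delta.
Qed.

Lemma ord_cases (j : ord) : [\/ (j < m)%N, j = oJ | j = oL].
Proof.
have [jm|mj] := ltnP j m; first by constructor 1.
have [jm|jm] := eqVneq (j : nat) m; first by constructor 2; apply/val_inj;
  rewrite /= vJ.
by constructor 3; apply/val_inj; rewrite /= vL; have := ltn_ord j; lia.
Qed.

Definition bundle_J s := exists i, cF (state_mx m s) i oJ = 1.
Definition bundle_L s := exists i, cF (state_mx m s) i oL = 1.

(** All columns of the target are trivial, so row m of P vanishes although P is invertible. *)
Lemma not_cohomologous_torus s : bundle_J s ->
  ~ cohomologous (state_mx m s) (state_mx m ((false, false), (false, false), false)).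
Proof.
move=> [i si] [P [Q [/matrixP/(_ oJ oJ) PQ _ H]]].
move: PQ; rewrite !mxE eqxx big1 // => j _.
rewrite (state_trivial_column H _ si) ?mul0r // => r; case: (ord_cases j) => [jm|->|->].
- exact: cF_state_lt.
- by rewrite cF_state_J !mulr0 addr0.
- by rewrite cF_state_L !mulr0 !addr0.
Qed.

Lemma row_JL P s t (j : ord) : bundle_J s -> bundle_L s ->
  preserves_relations (state_mx m s) (state_mx m t) P ->
    (forall r, cF (state_mx m t) r j = 0) ->
  P oJ j = 0 /\ P oL j = 0.
Proof. by move=> [i si] [i' si'] H tj; split; apply:
  (state_trivial_column H) => //; eauto. Qed.

(** Only column m of the target is nontrivial, so rows m and m + 1 of P are both supported there and
    are dependent. *)
Lemma not_cohomologous_klein s : bundle_J s -> bundle_L s ->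
  ~ cohomologous (state_mx m s) (state_mx m ((true, false), (false, false), false)).
Proof.
move=> sJ sL [P [Q [/matrixP PQ _ H]]].
have low (j : ord) (jm : (j < m)%N) := row_JL sJ sL H (fun r => cF_state_lt _ r jm).
have [PJL PLL] : P oJ oL = 0 /\ P oL oL = 0.
  by apply: (row_JL sJ sL H) => r; rewrite cF_state_L !mulr0 !addr0.
have JL : (oJ == oL) = false by rewrite -val_eqE /= vJ vL ltn_eqF.
have := PQ oJ oJ; rewrite (mulmx_two _ _ (fun j jm => (low j jm).1)) PJL mul0r addr0.
rewrite mxE eqxx => /mulF_eq1[PJ _].
have := PQ oL oL; rewrite (mulmx_two _ _ (fun j jm => (low j jm).2)) PLL mul0r addr0.
rewrite mxE eqxx => /mulF_eq1[_ QJL].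
have := PQ oJ oL; rewrite (mulmx_two _ _ (fun j jm => (low j jm).1)) PJL mul0r addr0.
by rewrite mxE JL PJ QJL.
Qed.

(** The last two rows of P vanish outside the last two columns, so the lower right 2 x 2 block of P
    times that of Q is the identity. *)
Lemma block_JL P Q s t : bundle_J s -> bundle_L s -> P *m Q = 1%:M ->
  preserves_relations (state_mx m s) (state_mx m t) P ->
  (forall j : ord, (j < m)%N -> P oJ j = 0 /\ P oL j = 0) /\
  P oJ oJ * P oL oL + P oJ oL * P oL oJ = 1.
Proof.
move=> sJ sL /matrixP PQ H.
have low (j : ord) (jm : (j < m)%N) := row_JL sJ sL H (fun r => cF_state_lt _ r jm).
split=> //.
have JL : (oJ == oL) = false by rewrite -val_eqE /= vJ vL ltn_eqF.
have PJ l := mulmx_two Q l (fun j jm => (low j jm).1).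
have PL l := mulmx_two Q l (fun j jm => (low j jm).2).
have : (P oJ oJ * P oL oL - P oJ oL * P oL oJ) * (Q oJ oJ * Q oL oL - Q oJ oL * Q oL
  oJ) =
  (P *m Q) oJ oJ * (P *m Q) oL oL - (P *m Q) oJ oL * (P *m Q) oL oJ.
  by rewrite !PJ !PL; ring.
rewrite !PQ !mxE !eqxx JL mul0r subr0 mulr1 => /mulF_eq1[<- _].
by rewrite oppF.
Qed.

(** With y = u + a, where a is the pullback of alpha_j, the products u_i u_k cancel in
    characteristic 2 and u_k^2 = u_k. *)
Lemma relation_sign P s t (j i k : ord) (a : ord -> 'F_2) :
  preserves_relations (state_mx m s) (state_mx m t) P ->
  (forall l, (P *m (cmx (state_mx m t) + 1%:M)) l j = P l j + a l) -> (i < k)%N ->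
  a i * P k j + a k * P i j + cF (state_mx m s) i k * (P k j + a k * P k j) = 0.
Proof.
move=> H ya ik; have := H j i k ik; rewrite /= !ya => <-.
rewrite [RHS](_ : _ = (P i j * P k j + P i j * P k j) + (a i * P k j + a k * P i j +
  cF (state_mx m s) i k * (P k j * P k j + a k * P k j))); last by ring.
by rewrite addFF add0r; case: (F2_cases (P k j)) => ->; rewrite !(mulr0, mulr1).
Qed.

(** For the last column of t and the pair (m, m + 1) of s, the relation says that the determinant of
    the 2 x 2 block is 0. *)
Lemma not_cohomologous_nested s t : bundle_J s -> bundle_L s -> s.2 = false ->
  t.2 -> ~ cohomologous (state_mx m s) (state_mx m t).
Proof.
move=> sJ sL s2 t2 [P [Q [PQ _ H]]].
have [low det] := block_JL sJ sL PQ H.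
have JL : (oJ < oL)%N by rewrite vJ vL.
have [lJ0 lL0] : P oJ oZ0 = 0 /\ P oL oZ0 = 0 by apply: low; rewrite vZ0 ltnW.
have [lJ1 lL1] : P oJ oZ1 = 0 /\ P oL oZ1 = 0 by apply: low; rewrite vZ1.
have JZ0 : (oJ == oZ0) = false by rewrite -val_eqE /= vJ vZ0; lia.
have JZ1 : (oJ == oZ1) = false by rewrite -val_eqE /= vJ vZ1; lia.
have := relation_sign H (y_L P t) JL; rewrite cF_state_L s2 t2 lJ0 lL0 lJ1 lL1 JZ0 JZ1.
rewrite !(mul0r, mulr0, add0r, addr0, mulr1) [P oL oJ * _]mulrC det.
by [].
Qed.

Lemma det_col (a b c d : 'F_2) : a * d + b * c = 1 -> b = 1 \/ d = 1.
Proof.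
case: (F2_cases b) => ->; last by left.
by rewrite mul0r addr0 => /mulF_eq1[]; right.
Qed.

(** Both signs of s equal x_0. The invertible block then forces the pullbacks of the two signs x_0
    and x_1 of t to be x_0 as well, so columns 0 and 1 of P coincide. *)
Lemma not_cohomologous_orientable :
  ~ cohomologous (state_mx m ((true, true), (false, false), false))
                 (state_mx m ((true, false), (false, true), false)).
Proof.
set s := (_, _, _); set t := (_, _, _) => -[P [Q [PQ QP H]]].
have Z10 : (oZ1 == oZ0) = false by rewrite -val_eqE /= vZ0 vZ1.
have Z01 : (oZ0 == oZ1) = false by rewrite eq_sym.
have JZ0 : (oJ == oZ0) = false by rewrite -val_eqE /= vJ vZ0; lia.
have Z0J : (oZ0 == oJ) = false by rewrite eq_sym.
have sJ : bundle_J s by exists oZ0;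
  rewrite cF_state_J eqxx Z01 /= !(mulr0, mul0r, addr0, add0r, mulr1).
have sL : bundle_L s by exists oZ0;
  rewrite cF_state_L eqxx Z01 Z0J /= !(mulr0, mul0r, addr0, add0r, mulr1).
have [low det] := block_JL sJ sL PQ H.
have [lJ0 lL0] : P oJ oZ0 = 0 /\ P oL oZ0 = 0 by apply: low; rewrite vZ0 ltnW.
have [lJ1 lL1] : P oJ oZ1 = 0 /\ P oL oZ1 = 0 by apply: low; rewrite vZ1.
suff eq01 i : P i oZ0 = P i oZ1.
  have : (Q *m P) oZ0 oZ0 = (Q *m P) oZ0 oZ1.
    by rewrite !mxE; apply: eq_bigr => j _; rewrite eq01.
  by rewrite QP !mxE eqxx Z01.
have [im|->|->] := ord_cases i; rewrite ?lJ0 ?lJ1 ?lL0 ?lL1 //.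
have sk k : k = oJ \/ k = oL -> cF (state_mx m s) i k = (i == oZ0)%:R.
  case=> ->; first by rewrite cF_state_J /= mulr1 mulr0 addr0.
  by rewrite cF_state_L /= mulr1 !mulr0 !addr0.
have iJ : (i < oJ)%N by rewrite vJ.
have iL : (i < oL)%N by rewrite vL ltnS ltnW.
have eqZ0 j : P oJ j = 1 \/ P oL j = 1 -> forall c,
    (forall l, (P *m (cmx (state_mx m t) + 1%:M)) l j = P l j + P l c) ->
    P oJ c = 0 -> P oL c = 0 -> P i c = (i == oZ0)%:R.
  move=> Pj c yE Jc Lc; suff /eqP : P i c + (i == oZ0)%:R = 0
    by rewrite addr_eq0 oppF => /eqP.
  case: Pj => Pj.
    by have := relation_sign H yE iJ;
      rewrite (sk oJ) ?Pj ?Jc ?(mul0r, addr0, mulr1) //; left.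
  by have := relation_sign H yE iL;
    rewrite (sk oL) ?Pj ?Lc ?(mul0r, addr0, mulr1) //; right.
rewrite (eqZ0 oJ _ oZ0) ?(eqZ0 oL _ oZ1) //.
- exact: det_col det.
- by move=> l; rewrite y_L /= mulr0 mulr0 mulr1 add0r addr0.
- by apply: det_col; rewrite addrC; exact: det.
- by move=> l; rewrite y_J /= mulr1 mulr0 addr0.
Qed.

Lemma not_cohomologous_iterated :
  ~ cohomologous (state_mx m ((true, false), (false, true), true))
                 (state_mx m ((true, false), (false, false), true)).
Proof.
set s := (_, _, _); set t := (_, _, _) => -[P [Q [PQ QP H]]].
have Z10 : (oZ1 == oZ0) = false by rewrite -val_eqE /= vZ0 vZ1.
have Z01 : (oZ0 == oZ1) = false by rewrite eq_sym.
have JZ0 : (oJ == oZ0) = false by rewrite -val_eqE /= vJ vZ0; lia.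
have Z0J : (oZ0 == oJ) = false by rewrite eq_sym.
have JZ1 : (oJ == oZ1) = false by rewrite -val_eqE /= vJ vZ1; lia.
have Z1J : (oZ1 == oJ) = false by rewrite eq_sym.
have sJ : bundle_J s by exists oZ0;
  rewrite cF_state_J eqxx Z01 /= !(mulr0, mul0r, addr0, add0r, mulr1).
have sL : bundle_L s by exists oZ1;
  rewrite cF_state_L eqxx Z10 Z1J /= !(mulr0, mul0r, addr0, add0r, mulr1).
have [low det] := block_JL sJ sL PQ H.
have [lJ0 lL0] : P oJ oZ0 = 0 /\ P oL oZ0 = 0 by apply: low; rewrite vZ0 ltnW.
have [lJ1 lL1] : P oJ oZ1 = 0 /\ P oL oZ1 = 0 by apply: low; rewrite vZ1.
have yJ l : (P *m (cmx (state_mx m t) + 1%:M)) l oJ = P l oJ + P l oZ0.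
  by rewrite y_J /= mulr1 mulr0 addr0.
have yL l : (P *m (cmx (state_mx m t) + 1%:M)) l oL = P l oL + P l oJ.
  by rewrite y_L /= !mulr0 mulr1 !add0r.
have JL : (oJ < oL)%N by rewrite vJ vL.
have Z0ltJ : (oZ0 < oJ)%N by rewrite vJ vZ0 ltnW.
have Z1ltJ : (oZ1 < oJ)%N by rewrite vJ vZ1.
have Z1ltL : (oZ1 < oL)%N by rewrite vL vZ1 ltnS ltnW.
have Z0ltZ1 : (oZ0 < oZ1)%N by rewrite vZ0 vZ1.
have cZ0J : cF (state_mx m s) oZ0 oJ = 1
  by rewrite cF_state_J eqxx Z01 /= !(mulr0, mul0r, addr0, add0r, mulr1).
have cZ1J : cF (state_mx m s) oZ1 oJ = 0
  by rewrite cF_state_J eqxx Z10 /= !(mulr0, mul0r, addr0, add0r, mulr1).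
have cZ1L : cF (state_mx m s) oZ1 oL = 1
  by rewrite cF_state_L eqxx Z10 Z1J /= !(mulr0, mul0r, addr0, add0r, mulr1).
have cJL : cF (state_mx m s) oJ oL = 1
  by rewrite cF_state_L eqxx JZ0 JZ1 /= !(mulr0, mul0r, addr0, add0r, mulr1).
have cZ01 : cF (state_mx m s) oZ0 oZ1 = 0 by rewrite cF_state_lt ?vZ1.
have PLJ : P oL oJ = 0.
  by have := relation_sign H yJ JL; rewrite cJL lJ0 lL0 !(mul0r, add0r, addr0, mul1r).
move: det; rewrite PLJ mulr0 addr0 => /mulF_eq1[PJJ PLL].
have P10 : P oZ1 oZ0 = 0.
  by have := relation_sign H yJ Z1ltJ; rewrite cZ1J PJJ lJ0 !(mul0r, addr0, mulr1).
have P00 : P oZ0 oZ0 = 1.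
  have := relation_sign H yJ Z0ltJ; rewrite cZ0J PJJ lJ0 !(mul0r, addr0, mulr1) => /eqP.
  by rewrite addr_eq0 oppF => /eqP.
have P1J : P oZ1 oJ = 0.
  by have := relation_sign H yJ Z0ltZ1; rewrite cZ01 P10 P00 !(mul0r, addr0, mul1r).
(* This relation now reads 1 = 0: s has the entry (1, m + 1), while the pullback of the last sign
   x_m of t has no component along x_1. *)
have := relation_sign H yL Z1ltL;
  rewrite cZ1L P1J PLL PLJ !(mul0r, addr0, add0r, mul1r).
by [].
Qed.

Lemma normal_inj s t : s \in normal_states -> t \in normal_states ->
  cohomologous (state_mx m s) (state_mx m t) ->
    cohomologous (state_mx m t) (state_mx m s) -> s = t.
Proof.
have Z10 : (oZ1 == oZ0) = false by rewrite -val_eqE /= vZ0 vZ1.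
have Z01 : (oZ0 == oZ1) = false by rewrite eq_sym.
have JZ0 : (oJ == oZ0) = false by rewrite -val_eqE /= vJ vZ0; lia.
have JZ1 : (oJ == oZ1) = false by rewrite -val_eqE /= vJ vZ1; lia.
have Z0J : (oZ0 == oJ) = false by rewrite eq_sym.
have Z1J : (oZ1 == oJ) = false by rewrite eq_sym.
have bJ (r : state) : r.1.1.1 -> bundle_J r.
  by move=> r1; exists oZ0; rewrite cF_state_J eqxx Z01 r1 mul0r addr0 mulr1.
have bL2 (r : state) : r.2 -> bundle_L r.
  by move=> r2; exists oJ; rewrite cF_state_L eqxx JZ0 JZ1 r2 !mul0r !add0r mulr1.
have bL0 (r : state) : r.1.1.2 -> bundle_L r.
  by move=> r2; exists oZ0; rewrite cF_state_L eqxx Z0J Z01 r2 !mul0r !addr0 mulr1.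
have bL1 (r : state) : r.1.2.2 -> bundle_L r.
  by move=> r2; exists oZ1; rewrite cF_state_L eqxx Z1J Z10 r2 !mul0r addr0 add0r mulr1.
rewrite !inE.
do 5?[case/orP]; move=> /eqP -> ; do 5?[case/orP]; move=> /eqP -> st ts //; exfalso.
(* Each pair of distinct forms is refuted by one of the two hypotheses. The targets are tried from
   the torus upwards, so the sources left have the nontrivial columns that each lemma asks for. *)
all: match goal with
  | H : cohomologous _ (state_mx m (false, false, (false, false), false)) |- _ =>
    apply: not_cohomologous_torus H
  | H : cohomologous _ (state_mx m (true, false, (false, false), false)) |- _ =>
    apply: not_cohomologous_klein H
  | H : cohomologous (state_mx m (_, false)) (state_mx m (_, true)) |- _ =>
    apply: not_cohomologous_nested H
  | H : cohomologous (state_mx m (true, true, _, _)) _ |- _ =>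
    exact: not_cohomologous_orientable H
  | H : cohomologous _ (state_mx m (_, (false, false), true)) |- _ =>
    exact: not_cohomologous_iterated H
  end.
all: try exact: bJ.
all: by [|apply: bL0|apply: bL1|apply: bL2].
Qed.

End Distinguish.

(** * Bott matrices with at most two nontrivial columns *)

Section BottNormal.
Local Open Scope ring_scope.
Variables (R : realType) (m : nat).
Hypothesis m2 : (2 <= m)%N.
Local Notation ord := 'I_(m.+2).

Lemma bott_state s : is_bott (state_mx m s).
Proof.
apply/andP; split; apply/forallP => i; first by rewrite mxE eqxx.
apply/forallP => j; apply/implyP => ji; rewrite mxE negb_or.
rewrite -val_eqE neq_ltn ji orbT /=; apply/negP => /off_diag_lt.
by rewrite ltnNge ltnW.
Qed.

Lemma max_torus_rank_state s : (m <= max_torus_rank (state_mx m s))%N.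
Proof.
rewrite -[leqLHS]card_ord; pose f (i : 'I_m) : ord := inord i.
have fE i : f i = i :> nat by apply: inordK; have := ltn_ord i; lia.
have finj : injective f by move=> i j /(congr1 val); rewrite /= !fE => /val_inj.
rewrite -(card_imset _ finj); apply: subset_leq_card.
apply/fintype.subsetP => _ /imsetP[i _ ->]; rewrite inE; apply/forallP => j.
apply/implyP => ji; rewrite mxE negb_or ji /= /off_diag fE (ltn_eqF (ltn_ord i)).
by rewrite ltn_eqF // ltnS ltnW.
Qed.

(** Padding the set of nontrivial columns to exactly two brings every case to one shape. *)
Lemma two_cover (S : {set ord}) : (#|S| <= 2)%N ->
  exists j l : ord, (j < l)%N /\ S \subset [set j; l].
Proof.
move=> S2; have [T ST /eqP/cards2P[j [l [jl TE]]]] : exists2 T :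
  {set ord}, S \subset T & #|T| = 2.
  have [S0|Sn0] := posnP #|S|.
    exists [set ord0; ord_max]; last by rewrite cards2 -val_eqE.
    by rewrite (cards0_eq S0) finset.sub0set.
  have [S1|Sn1] := eqVneq #|S| 1%N; last by exists S => //; apply/eqP;
    rewrite eqn_leq S2; lia.
  have /cards1P[x ->] : #|S| == 1%N by rewrite S1.
  exists [set x; if x == ord0 then ord_max else ord0].
    by apply/fintype.subsetP => y; rewrite !inE => ->.
  by rewrite cards2; case: (eqVneq x ord0) => [->|->].
have [lt|gt|/val_inj e] := ltngtP j l; last by rewrite e eqxx in jl.
  by exists j, l; rewrite -TE.
by exists l, j; rewrite finset.setUC -TE.
Qed.

Lemma bott_two_column A : is_bott A -> (m <= max_torus_rank A)%N ->
  exists w e, affine_equiv R A (two_column_mx m w e).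
Proof.
move=> /andP[/forallP A1 /forallP Alow] rA.
have [|j [l [jl /fintype.subsetP cov]]] :=
    @two_cover [set k | ~~ [forall i : ord, (i != k) ==> ~~ A i k]].
  set P := fun k : ord => [forall i : ord, (i != k) ==> ~~ A i k].
  have PC : #|[set k | ~~ P k]| = #|[predC P]|.
    by rewrite cardsE; apply: eq_card.
  have := cardC P; rewrite card_ord; have mP : (m <= #|P|)%N := rA.
  by move: PC mP; set c := #|_|; set d := #|P|; set d' := #|_|; lia.
have triv i k : k != j -> k != l -> cF A i k = 0.
  move=> kj kl; have : k \notin [set j; l] by rewrite !inE negb_or kj.
  move=> /(contra (cov k)); rewrite inE negbK => /forallP/(_ i).
  rewrite /cF; case: eqVneq => [->|_ /= /negbTE ->]; rewrite ?ltnn ?andbF //.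
have upper (i k : ord) : (i < k)%N && A i k = (i != k) && A i k.
  rewrite neq_ltn; case: ltnP => //= ki; case: ltnP => //= lt.
  by have /forallP/(_ k)/implyP/(_ lt)/negbTE -> := Alow i.
pose oM : ord := inord m; pose oL : ord := inord m.+1.
have vM : oM = m :> nat by rewrite inordK.
have vL : oL = m.+1 :> nat by rewrite inordK.
(* The first transposition moves j to m; the second moves the image of l to m + 1 and fixes m. As j
   < l, the entry (l, j) is 0, so the order of the two columns is respected. *)
pose s := (tperm j oM * tperm (tperm j oM l) oL)%g.
have ljn : l != j by rewrite -val_eqE neq_ltn jl orbT.
have sj : s j = oM.
  rewrite permM tpermL tpermD //; last by rewrite -val_eqE /= vM vL gtn_eqF.
  by rewrite -[X in _ != X](tpermL j oM) (inj_eq perm_inj).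
have sl : s l = oL by rewrite permM tpermL.
pose w k := (A (s^-1 (inord k))%g j, A (s^-1 (inord k))%g l).
exists w, (A j l); apply: (@affine_equiv_perm R _ _ _ s) => i k.
rewrite cF_two_column /off_diag.
have low r : r != j -> r != l -> (s r < m)%N.
  move=> rj rl; have : s r != oM by rewrite -sj (inj_eq perm_inj).
  have : s r != oL by rewrite -sl (inj_eq perm_inj).
  by rewrite -!val_eqE /= vM vL; have := ltn_ord (s r); lia.
have wE r : w (s r) = (A r j, A r l) by rewrite /w inord_val permK.
rewrite wE /=.
have [->|kj] := eqVneq k j.
  rewrite sj vM eqxx /cF upper.
  have [->|ij] := eqVneq i j; first by rewrite sj vM ltnn.
  have [->|il] := eqVneq i l.
    have /forallP/(_ j)/implyP/(_ jl)/negbTE -> := Alow l.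
    by rewrite sl vL andbF ltnNge leqnSn.
  by rewrite low.
have [->|kl] := eqVneq k l.
  rewrite sl vL gtn_eqF // eqxx /cF upper /=.
  have [->|ij] := eqVneq i j; first by rewrite sj vM ltnn eqxx eq_sym ljn.
  have [->|il] := eqVneq i l; first by rewrite sl vL ltnNge leqnSn gtn_eqF.
  by rewrite low.
have skm := low k kj kl.
by rewrite triv // (ltn_eqF skm) (ltn_eqF (ltnW skm : (s k < m.+1)%N)).
Qed.

End BottNormal.

Theorem theoremB (R : realType) (n : nat) (hn : (4 <= n)%N) :
  #|equivalence_partition
      (fun A B : 'M[bool]_n => `[< diffeomorphic R A B >])
      [set A : 'M[bool]_n | is_bott A & (n - 2 <= max_torus_rank A)%N]| = 6.
Proof.
case: n hn => [|[|m]] // hm; have m2 : (2 <= m)%N by [].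
rewrite subSS subSS subn0; set D := [set A :
  'M[bool]_(m.+2) | is_bott A & (m <= max_torus_rank A)%N].
pose E (A B : 'M[bool]_(m.+2)) := bott_equiv (fun _ : 'rV[R]_(m.+2) ->
  'rV[R]_(m.+2) => True) A B.
have Esym A B : E A B -> E B A by exact: bott_equiv_sym.
have Etrans A B C : E A B -> E B C -> E A C by exact: bott_equiv_trans.
have Ediff A B : diffeomorphic R A B -> E A B by exact: diffeomorphic_equiv.
have Eaff A B : affine_equiv R A B -> E A B by apply: bott_equivW.
have normal A : A \in D -> exists2 s, s \in normal_states & affine_equiv R A
  (state_mx m s).
  rewrite inE => /andP[bA rA]; have [w [e Aw]] := bott_two_column R m2 bA rA.
  have [s sN ws] := affine_equiv_normal R m2 w e.
  by exists s => //; exact: affine_equiv_trans Aw ws.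
have normal_in_D s : state_mx m s \in D by rewrite inE bott_state max_torus_rank_state.
have nE s t : s \in normal_states -> t \in normal_states ->
  E (state_mx m s) (state_mx m t) -> s = t.
  move=> sN tN st; apply: (normal_inj m2) => //; apply: bott_equiv_cohomologous.
    exact: st.
  exact: Esym st.
(* The loop closes here: A reduces affinely to some normal form t, and the invariants force t =
   s. *)
have diffE A s : A \in D -> s \in normal_states -> E A (state_mx m s) ->
    affine_equiv R A (state_mx m s).
  move=> AD sN As; have [t tN At] := normal A AD.
  by rewrite (nE s t) //; apply: Etrans (Eaff _ _ At); exact: Esym.
pose cls s := [set B in D | `[< diffeomorphic R (state_mx m s) B >]].
(* Each class is that of a normal form, and distinct forms give distinct classes because a class
   contains its own form. *)
rewrite (_ : equivalence_partition _ _ = [set cls s | s in normal_states]).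
  rewrite card_in_imset; first exact: card_uniqP.
  move=> s t sN tN /finset.setP/(_ (state_mx m t)).
  rewrite [in LHS]finset.in_set [in RHS]finset.in_set normal_in_D /= => st.
  have tt : diffeomorphic R (state_mx m t) (state_mx m t).
    by apply: bott_equiv_diffeomorphic; exact: affine_equiv_refl.
  by apply: nE => //; apply: Ediff; apply/asboolP; rewrite st; apply/asboolP.
have clsE A s : A \in D -> s \in normal_states -> affine_equiv R A (state_mx m s) ->
    [set B in D | `[< diffeomorphic R A B >]] = cls s.
  move=> AD sN As; apply/finset.setP => B;
    rewrite [in LHS]finset.in_set [in RHS]finset.in_set.
  case BD : (B \in D) => //=.
  apply/asboolP/asboolP => /Ediff H; apply: bott_equiv_diffeomorphic.
    have sA : E (state_mx m s) A by apply: Esym; exact: Eaff.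
    exact/affine_equiv_sym/(diffE _ _ BD sN)/Esym/(Etrans _ _ _ sA H).
  exact: affine_equiv_trans As (affine_equiv_sym (diffE _ _ BD sN (Esym _ _ H))).
apply/finset.setP => X; apply/imsetP/imsetP => [[A AD ->]|[s sN ->]].
  by have [s sN As] := normal A AD; exists s => //; exact: clsE.
exists (state_mx m s) => //; apply/esym/clsE => //; exact: affine_equiv_refl.
Qed.
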